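(* Let $a,c>0$ and $d>1$, and consider the multitype Galton–Watson process $\{\boldsymbol Z_n\}$ with type set $\{1,2,3,\dots\}$ and progeny generating functions $$G_1(\boldsymbol s)=\frac{cd}{t}s_2^t+1-\frac{cd}{t},$$ and, for $i\ge2$, $$G_i(\boldsymbol s)=\begin{cases}\dfrac{cd}{u}s_{i+1}^u+\dfrac{ad}{u}s_{i-1}^u+1-\dfrac{d(a+c)}{u}&\text{when }i\text{ is odd},\\[2mm]\dfrac{c}{dv}s_{i+1}^v+\dfrac{a}{dv}s_{i-1}^v+1-\dfrac{a+c}{dv}&\text{when }i\text{ is even},\end{cases}$$ where $t=\lceil dc\rceil+1$, $u=\lceil d(c+a)\rceil+1$ and $v=\lceil(c+a)/d\rceil+1$. Let the replacement distributions be $\boldsymbol\alpha^{(k)}=\boldsymbol e_k$ for all $k\ge1$ (every individual of type larger than $k$ is replaced by type $k$). Then $\lim_{k\to\infty}\bar{\boldsymbol q}^{(k)}=\boldsymbol q$ when $ac>1/4$. Additionally, $\tilde{\boldsymbol q}=\boldsymbol1$ if and only if $ac\le1/4$, and when this is satisfied: (i) if $d^{-1}>\dfrac{1+\sqrt{1-4ac}}{2c}$ then $\lim_{k\to\infty}\bar{\boldsymbol q}^{(k)}=\boldsymbol q$; (ii) if $d^{-1}\le\dfrac{1+\sqrt{1-4ac}}{2c}<d$ then $\lim_{k\to\infty}\bar{\boldsymbol q}^{(2k+1)}=\boldsymbol q$ and $\lim_{k\to\infty}\bar{\boldsymbol q}^{(2k)}=\tilde{\boldsymbol q}=\boldsymbol1$;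 (iii) if $d\le\dfrac{1+\sqrt{1-4ac}}{2c}$ then $\lim_{k\to\infty}\bar{\boldsymbol q}^{(k)}=\tilde{\boldsymbol q}=\boldsymbol q=\boldsymbol1$.
   Context: A multitype Galton–Watson process $\{\boldsymbol Z_n\}_{n\ge0}$ with type set $\mathcal S=\{1,2,\dots\}$ starts from a single individual (type $\varphi_0$); each individual lives one generation and independently of all others produces offspring, a type-$i$ individual producing $r_j$ offspring of type $j$ ($j\ge1$) with probability $p_i(\boldsymbol r)$; its progeny generating function is $G_i(\boldsymbol s)=\sum_{\boldsymbol r}p_i(\boldsymbol r)\prod_js_j^{r_j}$. $Z_{n,j}$ is the number of type-$j$ individuals in generation $n$, $|\boldsymbol Z_n|=\sum_jZ_{n,j}$, and $\mathbf P_i(\cdot)=\mathbf P(\cdot\mid\varphi_0=i)$. The global and partial extinction probability vectors are $\boldsymbol q=(q_i)$, $q_i=\mathbf P_i(\lim_n|\boldsymbol Z_n|=0)$, and $\tilde{\boldsymbol q}=(\tilde q_i)$, $\tilde q_i=\mathbf P_i(\forall l:\lim_nZ_{n,l}=0)$. For $k\ge1$ and a probability distribution $\boldsymbol\alpha^{(k)}$ on $\{1,\dots,k\}$, $\{\bar{\boldsymbol Z}^{(k)}_n\}$ is the branching process in which types in $\{1,\dots,k\}$ have the same progeny distribution as in $\{\boldsymbol Z_n\}$, except that every individual of type larger than $k$ is instantaneously, and independently of everything else, replaced by an individual whose type is drawn from $\boldsymbol\alpha^{(k)}$; $\bar{\boldsymbol q}^{(k)}=(\bar q^{(k)}_i)_{i\ge1}$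 with $\bar q^{(k)}_i=\mathbf P_i(\lim_n|\bar{\boldsymbol Z}^{(k)}_n|=0)$ is its extinction probability vector. $\boldsymbol e_k$ denotes the distribution putting mass one on type $k$. Limits of vectors are entrywise. *)

(* Defs.v *)
From HB Require Import structures.
From mathcomp Require Import all_boot all_order all_algebra finmap multiset.
From mathcomp Require Import all_classical all_reals all_analysis.

Set Implicit Arguments.
Unset Strict Implicit.
Unset Printing Implicit Defensive.

Import Order.TTheory GRing.Theory Num.Theory.
Import numFieldNormedType.Exports.

Local Open Scope classical_set_scope.
Local Open Scope ring_scope.

(* Types are the natural numbers i >= 1; the index 0 is junk, and everything
   below is only meant (and only assumed) for positive types.
   A population vector r = (r_1, r_2, ...) is a finite multiset of types, r j
   being the number of individuals of type j. *)
Notation config := {mset nat}%mset.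

Definition total (r : config) : nat := (\sum_(j <- finsupp r) r j)%N.

Section OffspringLaws.
Context {R : realType}.

Definition is_offspring_law (pi : config -> R) : Prop :=
  (forall r, 0 <= pi r) /\ \esum_(r in [set: config]) (pi r)%:E = 1%E.

Definition progeny_gf (pi : config -> R) (s : nat -> R) : \bar R :=
  \esum_(r in [set: config]) (pi r * \prod_(j <- finsupp r) s j ^+ r j)%:E.

Definition is_distribution_upto (k : nat) (alpha : nat -> R) : Prop :=
  [/\ forall j, 0 <= alpha j,
      forall j, ~~ (1 <= j <= k)%N -> alpha j = 0
    & \sum_(1 <= j < k.+1) alpha j = 1].

Definition point_mass (k : nat) : nat -> R := fun j => (j == k)%:R.

End OffspringLaws.

(* Genealogical labels: the root is [::], and rcons v (j, l) is the l-th child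
   (l = 0, 1, ...) born with type j to the individual labelled v. *)
Definition label := seq (nat * nat).

Definition children (r : config) : seq (nat * nat) :=
  [seq (j, l) | j <- finsupp r, l <- iota 0 (r j)].

Section Genealogy.
(* off v i : offspring vector of the individual labelled v if its type is i;
   retype v j : type effectively taken by the individual labelled v when its
   original type is j. *)
Variables (off : label -> nat -> config) (retype : label -> nat -> nat).

(* The individuals of the n-th generation, as pairs (label, type), when the
   original type of the initial individual is i. *)
Fixpoint generation (i n : nat) : seq (label * nat) :=
  if n is m.+1 then
    [seq (rcons x.1 b, retype (rcons x.1 b) b.1)
       | x <- generation i m, b <- children (off x.1 x.2)]
  else [:: ([::], retype [::] i)].

Definition population (i n : nat) : config :=
  seq_mset [seq x.2 | x <- generation i n].

End Genealogy.

Section Processes.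
Context {d : measure_display} {T : measurableType d}.

Definition Z (xi : label -> nat -> T -> config) (i n : nat) (w : T) : config :=
  population (fun v j => xi v j w) (fun _ j => j) i n.

(* Individuals of type larger than k, including the initial one, are
   replaced. *)
Definition Zbar (xi : label -> nat -> T -> config) (k : nat)
    (rho : label -> T -> nat) (i n : nat) (w : T) : config :=
  population (fun v j => xi v j w)
    (fun v j => if (j <= k)%N then j else rho v w) i n.

Context {R : realType} (P : probability T R).

(* Random elements of spaces equipped with their discrete sigma-algebra. *)
Definition discrete_random (V : Type) (X : T -> V) : Prop :=
  forall A : set V, measurable (X @^-1` A).

Definition mutually_independent (I : choiceType) (V : I -> Type)
    (X : forall i, T -> V i) : Prop :=
  forall (J : {fset I}) (A : forall i, set (V i)),
    P (\bigcap_(i in [set` J]) (X i @^-1` A i)) =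
    (\prod_(i <- J) P (X i @^-1` A i))%E.

(* The offspring variables xi and the replacement variables rho, gathered in
   one family. *)
Definition driving_value (x : label * nat + label) : Type :=
  if x is inl _ then config else nat.

Definition driving_family (xi : label -> nat -> T -> config)
    (rho : label -> T -> nat) (x : label * nat + label) :
    T -> driving_value x :=
  match x return T -> driving_value x with
  | inl vi => xi vi.1 vi.2
  | inr v => rho v
  end.

Record offspring_variables (p : nat -> config -> R)
    (xi : label -> nat -> T -> config) : Prop := {
  offspring_law : forall i, (0 < i)%N -> is_offspring_law (p i);
  offspring_measurable : forall v i, discrete_random (xi v i);
  offspring_distr : forall v i r, (0 < i)%N ->
    P (xi v i @^-1` [set r]) = (p i r)%:E;
  offspring_indep :
    mutually_independent (fun vi : label * nat => xi vi.1 vi.2) }.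

Record replacement_variables (xi : label -> nat -> T -> config) (k : nat)
    (alpha : nat -> R) (rho : label -> T -> nat) : Prop := {
  replacement_law : is_distribution_upto k alpha;
  replacement_measurable : forall v, discrete_random (rho v);
  replacement_distr : forall v j, P (rho v @^-1` [set j]) = (alpha j)%:E;
  replacement_indep : mutually_independent (driving_family xi rho) }.

(* For a process started from type i (first argument of Y), Pr is the
   probability under P_i. *)
Definition global_extinction (Y : nat -> nat -> T -> config) (i : nat) : R :=
  fine (P [set w | (fun n => (total (Y i n w))%:R : R) @ \oo --> (0 : R)]).

Definition partial_extinction (Y : nat -> nat -> T -> config) (i : nat) : R :=
  fine (P [set w | forall l, (0 < l)%N ->
                     (fun n => (Y i n w l)%:R : R) @ \oo --> (0 : R)]).

End Processes.

Section EntrywiseLimits.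
Context {R : realType}.

Definition eq_vec (x y : nat -> R) : Prop :=
  forall i, (0 < i)%N -> x i = y i.

Definition cvg_vec (x : nat -> nat -> R) (y : nat -> R) : Prop :=
  forall i, (0 < i)%N -> (fun k => x k i) @ \oo --> y i.

End EntrywiseLimits.

(* The ceilings are integers; they are taken of positive reals only, so that
   the absolute value is just the cast to nat. *)
Definition ceiln {R : realType} (x : R) : nat := `|Num.ceil x|%N.

Definition G {R : realType} (a c d : R) (i : nat) (s : nat -> R) : R :=
  let t := (ceiln (d * c)).+1 in
  let u := (ceiln (d * (c + a))).+1 in
  let v := (ceiln ((c + a) / d)).+1 in
  if i == 1%N then
    c * d / t%:R * s 2%N ^+ t + 1 - c * d / t%:R
  else if odd i then
    c * d / u%:R * s i.+1 ^+ u + a * d / u%:R * s i.-1 ^+ u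
    + 1 - d * (a + c) / u%:R
  else
    c / (d * v%:R) * s i.+1 ^+ v + a / (d * v%:R) * s i.-1 ^+ v
    + 1 - (a + c) / (d * v%:R).

(* Main.v *)
(* For a set of types, the probability that generation n avoids it
   is the n-th iterate of the progeny generating functions, so that in terms of
   f = 1 - s everything is governed by the operator F f = 1 - G (1 - f); for the
   replaced process F is precomposed with min k.  F lies below the mean matrix
   M, is close to it for small f, and is concave.  Conjugating by the weight d on
   odd types turns M into the homogeneous walk g |-> c g_(i+1) + a g_(i-1), with
   characteristic polynomial c y^2 - y + a, whose largest root is x when
   a c <= 1/4.

   When a c <= 1/4, g_i = x^i - y^i with y small is strictly superharmonic. Hence
   the Green function is finite, and Borel-Cantelli gives partial extinction.
   Replacing k+1 by k keeps this g superharmonic as soon as d <= x (k odd) or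
   1/d <= x (k even), and then a maximum principle gives extinction of the
   replaced process.  The same principle gives global extinction when x > 1; at
   x = 1 the quadratic loss of F against M does.

   Conversely, positive subharmonic functions h give f = eta h with f <= F f,
   hence lower bounds for survival: a parabola times a geometric sequence on a
   window of fixed length when a c > 1/4; when x < 1 and the top of the replaced
   process is favourable, 1 - x^i glued near the top to y^j - x^j with x < y.
   These bounds are uniform in the initial type, and then concavity of F forces
   the extinction probabilities of the replaced processes to converge to q. *)

Require Import Defs.
From HB Require Import structures.
From mathcomp Require Import all_boot all_order all_algebra finmap multiset.
From mathcomp Require Import all_classical all_reals all_analysis.
From mathcomp Require Import zify ring lra.
Import Order.TTheory GRing.Theory Num.Theory.
Import numFieldNormedType.Exports.
Local Open Scope classical_set_scope.
Local Open Scope ring_scope.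
Set Implicit Arguments.
Unset Strict Implicit.
Unset Printing Implicit Defensive.

(** * Survival operator *)

Section Loss.
Context {R : realType}.
Implicit Types (x y t : R) (m : nat).

(** The probability that at least one of [m] independent lines survives, each with probability
    [x]. *)
Definition loss m x : R := 1 - (1 - x) ^+ m.

Lemma lossS m x : loss m.+1 x = x + (1 - x) * loss m x.
Proof. by rewrite /loss exprS; ring. Qed.

Lemma loss_ge0 m x : 0 <= x <= 1 -> 0 <= loss m x.
Proof. by move=> /andP[x0 x1]; rewrite subr_ge0 exprn_ile1// ?subr_ge0// gerBl. Qed.

Lemma loss_le1 m x : 0 <= x <= 1 -> loss m x <= 1.
Proof. by move=> /andP[x0 x1]; rewrite gerBl exprn_ge0// subr_ge0. Qed.

Lemma ler_loss m x y : x <= y <= 1 -> loss m x <= loss m y.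
Proof.
move=> /andP[xy y1]; rewrite lerB// lerXn2r ?nnegrE ?subr_ge0 ?lerB//.
exact: le_trans y1.
Qed.

Lemma loss_geid m x : (0 < m)%N -> 0 <= x <= 1 -> x <= loss m x.
Proof.
case: m => // m _ x01; rewrite lossS lerDl mulr_ge0 ?loss_ge0//.
by case/andP: x01; rewrite subr_ge0.
Qed.

(** Equality at [m = 2]; by [lossS] each further child adds at most [x]. The quadratic term, which
    would be false for [m = 1], drives the critical case. *)
Lemma loss_le m x : (1 < m)%N -> 0 <= x <= 1 -> loss m x <= m%:R * x - x ^+ 2.
Proof.
case: m => [//|[//|m]] _ x01; elim: m => [|m IH].
  by rewrite /loss le_eqVlt; apply/orP; left; apply/eqP; ring.
rewrite lossS -(@natr1 _ m.+2) [leRHS]addrC [in leRHS]mulrDl mul1r.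
have := loss_ge0 m.+2 x01; case/andP: x01 => x0 _.
move: (loss _ _) (x ^+ 2) (_ * x) IH => l X Y lXY l0.
by have := mulr_ge0 x0 l0; lra.
Qed.

Lemma loss_ge m x : 0 <= x <= 1 -> m%:R * x * (1 - m%:R * x) <= loss m x.
Proof.
move=> /andP[x0 x1]; elim: m => [|m IH]; first by rewrite /loss; lra.
rewrite lossS -natr1; have : 0 <= m%:R :> R by [].
move: (m%:R : R) (loss m x) IH => r l IH r0.
have : (1 - x) * (r * x * (1 - r * x)) <= (1 - x) * l by rewrite ler_wpM2l// subr_ge0.
have : 0 <= x ^+ 2 * (r + 1 + r ^+ 2 * x) by rewrite mulr_ge0 ?sqr_ge0// !addr_ge0//
  mulr_ge0// sqr_ge0.
by rewrite -subr_ge0 => A; rewrite -subr_ge0 => B; nra.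
Qed.

(** Again an equality at [m = 2]. In the inductive step the gap is at least
    [t * (1 - t) * x * (l - t * x ^+ 2)], with [l] the loss of the previous order, and [x <= l]
    makes this nonnegative. *)
Lemma loss_concave m x t : (1 < m)%N -> 0 <= x <= 1 -> 0 <= t <= 1 ->
  t * loss m x + t * (1 - t) * x ^+ 2 <= loss m (t * x).
Proof.
case: m => [//|[//|m]] _ x01 t01; elim: m => [|m IH].
  by rewrite /loss le_eqVlt; apply/orP; left; apply/eqP; ring.
rewrite (lossS m.+2 x) (lossS m.+2 (t * x)).
have := @loss_geid m.+2 x isT x01.
case/andP: x01 => x0 x1; case/andP: t01 => t0 t1.
move: (loss m.+2 x) (loss m.+2 (t * x)) IH => l l' IH xl.
have tx1 : 0 <= 1 - t * x by rewrite subr_ge0 mulr_ile1.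
have : (1 - t * x) * (t * l + t * (1 - t) * x ^+ 2) <= (1 - t * x) * l'
  by rewrite ler_wpM2l.
have : 0 <= t * (1 - t) * x * (l - t * x ^+ 2).
  rewrite !mulr_ge0// ?subr_ge0//.
  by apply: le_trans xl; rewrite expr2 mulrA -[leRHS]mul1r ler_wpM2r// mulr_ile1.
move=> A B; rewrite -subr_ge0; rewrite -subr_ge0 in B.
by have := addr_ge0 A B; congr (0 <= _); ring.
Qed.
End Loss.

Section Kernel.
Context {R : realType} (a c d : R).
Hypotheses (a_gt0 : 0 < a) (c_gt0 : 0 < c) (d_gt1 : 1 < d).
Implicit Types (f g : nat -> R) (i : nat).

(** A mean is the probability of a brood times its size, so the ceilings cancel. The zeros at types
    0 and 1 keep the junk type 0 dead and unproduced. *)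
Definition mean_up i : R := if i == 0 then 0 else if odd i then c * d else c / d.
Definition mean_down i : R := if (i <= 1)%N then 0 else if odd i then a * d else a / d.
Definition brood i : nat :=
  if i == 1%N then (ceiln (d * c)).+1
  else if odd i then (ceiln (d * (c + a))).+1
  else (ceiln ((c + a) / d)).+1.
Definition max_brood : nat :=
  (ceiln (d * c) + ceiln (d * (c + a)) + ceiln ((c + a) / d)).+1.

Definition mean_op f i : R := mean_up i * f i.+1 + mean_down i * f i.-1.
Definition surv_op f i : R :=
  mean_up i / (brood i)%:R * loss (brood i) (f i.+1)
  + mean_down i / (brood i)%:R * loss (brood i) (f i.-1).

Let d_gt0 : 0 < d. Proof. exact: lt_trans d_gt1. Qed.

Lemma mean_up_ge0 i : 0 <= mean_up i.
Proof. by rewrite /mean_up; do 2 case: ifP => // _; rewrite ?mulr_ge0 ?invr_ge0// ltW. Qed.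

Lemma mean_down_ge0 i : 0 <= mean_down i.
Proof. by rewrite /mean_down; do 2 case: ifP => // _; rewrite ?mulr_ge0 ?invr_ge0// ltW.
  Qed.

Lemma le_ceiln (x : R) : 0 <= x -> x <= (ceiln x)%:R.
Proof.
move=> x0; apply: le_trans (Num.Theory.ceil_ge x) _.
by rewrite /ceiln natr_absz ler_int ler_norm.
Qed.

Lemma ceiln_gt0 (x : R) : 0 < x -> (0 < ceiln x)%N.
Proof. by move=> x0; rewrite -(ltr_nat R) (lt_le_trans x0)// le_ceiln// ltW. Qed.

Lemma brood_gt1 i : (1 < brood i)%N.
Proof.
rewrite /brood; do 2?[case: ifP => _]; rewrite ltnS ceiln_gt0//.
- by rewrite mulr_gt0.
- by rewrite mulr_gt0// addr_gt0.
- by rewrite divr_gt0// addr_gt0.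
Qed.

Lemma brood_le i : (brood i <= max_brood)%N.
Proof. by rewrite /brood /max_brood; do 2?[case: ifP => _]; lia. Qed.

Lemma brood_gt0 i : 0 < (brood i)%:R :> R.
Proof. by rewrite ltr0n (ltn_trans _ (brood_gt1 i)). Qed.

(** The two terms are the probabilities of the two nonempty broods; the ceilings in the brood sizes
    are there to make this sum at most 1. *)
Lemma mean_up_down_le1 i : mean_up i / (brood i)%:R + mean_down i / (brood i)%:R <= 1.
Proof.
rewrite -mulrDl ler_pdivrMr ?brood_gt0// mul1r /mean_up /mean_down /brood.
have le1 (x : R) : 0 <= x -> x <= (ceiln x).+1%:R.
  by move=> x0; rewrite (le_trans (le_ceiln x0))// ler_nat.
case: i => [|[|i]] /=; first by rewrite addr0.
  by rewrite addr0 mulrC le1// ltW// mulr_gt0.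
case: ifP => _; first by rewrite -mulrDl mulrC le1// ltW// mulr_gt0// addr_gt0.
by rewrite -mulrDl le1// ltW// divr_gt0// addr_gt0.
Qed.

Lemma surv_op_G (s : nat -> R) i : (0 < i)%N -> surv_op (fun j => 1 - s j) i = 1 - G a c
  d i s.
Proof.
rewrite /surv_op /G /loss /mean_up /mean_down /brood; case: i => [//|[|i]] _ /=.
  by rewrite !subKr; ring.
have dn0 : d != 0 by rewrite gt_eqF.
rewrite !subKr; case: ifP => oi.
  move: (ceiln _).+1 (ltn0Sn (ceiln (d * (c + a)))) => m m0.
  have {m0} : m%:R != 0 :> R by rewrite pnatr_eq0 -lt0n.
  by move: (m%:R : R) (_ ^+ m) (_ ^+ m) => r x y r0; field.
move: (ceiln _).+1 (ltn0Sn (ceiln ((c + a) / d))) => m m0.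
have {m0} : m%:R != 0 :> R by rewrite pnatr_eq0 -lt0n.
by move: (m%:R : R) (_ ^+ m) (_ ^+ m) => r x y r0; field; rewrite r0.
Qed.

Definition unit_vec f := forall i, 0 <= f i <= 1.

Lemma ler_surv_op f g : unit_vec g -> (forall i, f i <= g i) -> forall i, surv_op f i <=
  surv_op g i.
Proof.
move=> g01 fg i.
have gl j : f j <= g j <= 1 by rewrite fg; case/andP: (g01 j).
by rewrite lerD// ler_wpM2l ?divr_ge0 ?mean_up_ge0 ?mean_down_ge0 ?ler_loss.
Qed.

Lemma surv_op_unit f : unit_vec f -> unit_vec (surv_op f).
Proof.
move=> f01 i; apply/andP; split.
  by rewrite addr_ge0// mulr_ge0 ?loss_ge0 ?divr_ge0 ?mean_up_ge0 ?mean_down_ge0.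
apply: le_trans (mean_up_down_le1 i).
by rewrite lerD// ler_piMr ?loss_le1 ?divr_ge0 ?mean_up_ge0 ?mean_down_ge0.
Qed.

Lemma surv_op_le_quadratic f i : unit_vec f -> surv_op f i <= mean_op f i -
   (mean_up i / (brood i)%:R * f i.+1 ^+ 2 + mean_down i / (brood i)%:R * f i.-1 ^+ 2).
Proof.
move=> f01; have bn0 := brood_gt0 i.
have L j : loss (brood i) (f j) <= (brood i)%:R * f j - f j ^+ 2.
  by rewrite loss_le ?brood_gt1.
rewrite [leRHS](_ : _ = mean_up i / (brood i)%:R * ((brood i)%:R * f i.+1 - f i.+1 ^+ 2)
   + mean_down i / (brood i)%:R * ((brood i)%:R * f i.-1 - f i.-1 ^+ 2)).
  by rewrite lerD// ler_wpM2l ?divr_ge0 ?mean_up_ge0 ?mean_down_ge0.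
by rewrite /mean_op; field; rewrite gt_eqF.
Qed.

Lemma surv_op_le_mean f i : unit_vec f -> surv_op f i <= mean_op f i.
Proof.
move=> f01; apply: le_trans (surv_op_le_quadratic i f01) _; rewrite gerBl addr_ge0//
  mulr_ge0//.
- by rewrite divr_ge0 ?mean_up_ge0.
- by rewrite sqr_ge0.
- by rewrite divr_ge0 ?mean_down_ge0.
- by rewrite sqr_ge0.
Qed.

Lemma surv_op_ge f i (e : R) : unit_vec f -> (forall j, f j <= e) ->
  (1 - max_brood%:R * e) * mean_op f i <= surv_op f i.
Proof.
move=> f01 fe; have bn0 := brood_gt0 i.
have L j : (brood i)%:R * ((1 - max_brood%:R * e) * f j) <= loss (brood i) (f j).
  apply: le_trans (loss_ge _ (f01 j)).
  have /andP[fj0 _] := f01 j.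
  rewrite mulrCA [leRHS]mulrC ler_wpM2r// ?mulr_ge0// lerB// ler_pM// ler_nat.
  exact: brood_le.
rewrite /mean_op /surv_op mulrDr lerD//.
  rewrite [leLHS](_ : _ = mean_up i / (brood i)%:R * ((brood i)%:R * ((1 - max_brood%:R *
    e) * f i.+1))).
    by rewrite ler_wpM2l ?divr_ge0 ?mean_up_ge0.
  by field; rewrite gt_eqF.
rewrite [leLHS](_ : _ = mean_down i / (brood i)%:R * ((brood i)%:R * ((1 - max_brood%:R *
  e) * f i.-1))).
  by rewrite ler_wpM2l ?divr_ge0 ?mean_down_ge0.
by field; rewrite gt_eqF.
Qed.

(* The gain over concavity comes from brood sizes being at least 2. *)
Lemma surv_op_concave f (e t : R) i : unit_vec f -> (forall j, (0 < j)%N -> e <= f j) ->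
  0 <= e -> 0 <= t <= 1 ->
  (t + t * (1 - t) * (e / max_brood%:R)) * surv_op f i <= surv_op (fun j => t * f j) i.
Proof.
move=> f01 ef e0 t01; have bn0 := brood_gt0 i.
have /andP[t0 t1] := t01; have t1' : 0 <= 1 - t by rewrite subr_ge0.
have L j : (0 < j)%N -> (t + t * (1 - t) * (e / max_brood%:R)) * loss (brood i) (f j)
    <= loss (brood i) (t * f j).
  move=> j0; apply: le_trans (loss_concave (brood_gt1 i) (f01 j) t01).
  rewrite mulrDl lerD2l -mulrA ler_wpM2l ?mulr_ge0// expr2.
  have /andP[fj0 _] := f01 j.
  (* Through [e * f j]: a loss is at most [max_brood * f j], and [e <= f j]. *)
  apply: (@le_trans _ _ (e * f j)); last by rewrite ler_wpM2r ?ef.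
  rewrite -mulrA ler_wpM2l// ler_pdivrMl ?ltr0n//.
  apply: le_trans (loss_le (brood_gt1 i) (f01 j)) _.
  rewrite (@le_trans _ _ ((brood i)%:R * f j))// ?gerBl ?sqr_ge0//.
  by rewrite ler_wpM2r// ler_nat brood_le.
rewrite /surv_op mulrDr lerD//.
  by rewrite mulrCA ler_wpM2l ?divr_ge0 ?mean_up_ge0 ?L.
(* [mean_down] vanishes for [i <= 1], so the bound [e <= f j] is only called at positive [j]. *)
have [i1|i1] := leqP i 1; first by rewrite /mean_down i1 !mul0r mulr0.
by rewrite mulrCA ler_wpM2l ?divr_ge0 ?mean_down_ge0 ?L//; case: i i1 {bn0 L} => [|[]].
Qed.

End Kernel.

(** * Survival probabilities as iterates *)

Section Survival.
Context {R : realType} (a c d : R).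
Hypotheses (a_gt0 : 0 < a) (c_gt0 : 0 < c) (d_gt1 : 1 < d).
Implicit Types (f g : nat -> R) (i n k : nat).
Local Notation F := (surv_op a c d).
Local Notation M := (mean_op a c d).
Local Notation B := (max_brood a c d)%:R.

Lemma exprn_lt_small (r e : R) : 0 <= r < 1 -> 0 < e -> exists n, r ^+ n < e.
Proof.
move=> /andP[r0 r1] e0; have := @cvg_expr R r.
rewrite ger0_norm// => /(_ r1)/cvgrPdist_lt/(_ _ e0)[n _ /(_ n (leqnn n))].
by rewrite /= sub0r normrN ger0_norm ?exprn_ge0//; exists n.
Qed.

Lemma surv_op_at0 f : F f 0%N = 0.
Proof. by rewrite /surv_op /mean_up /mean_down /= !mul0r addr0. Qed.

Lemma mean_op_at0 f : M f 0%N = 0.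
Proof. by rewrite /mean_op /mean_up /mean_down /= !mul0r addr0. Qed.

Lemma ler_mean_op f g : (forall i, f i <= g i) -> forall i, M f i <= M g i.
Proof. by move=> fg i; rewrite lerD// ler_wpM2l ?mean_up_ge0 ?mean_down_ge0. Qed.

Lemma mean_opZ (t : R) f i : M (fun j => t * f j) i = t * M f i.
Proof. by rewrite /mean_op; ring. Qed.

(** [phi] retypes newborns: [id] for the original process, [minn k] for the replaced one. The
    argument of the resulting function is the type of the ancestor after its own retyping. *)
Definition surv (phi : nat -> nat) f n : nat -> R :=
  iter n (fun f => F (f \o phi)) f.

Lemma surv_unit phi f n : unit_vec f -> unit_vec (surv phi f n).
Proof. by move=> f01; elim: n => //= n IH; apply: surv_op_unit => // i /=; exact: IH. Qed.

Lemma surv_ge phi f g n : unit_vec g -> (forall i, f i <= g i) ->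
  (forall i, f i <= F (f \o phi) i) -> forall i, f i <= surv phi g n i.
Proof.
move=> g01 fg fF; elim: n => //= n IH i; apply: le_trans (fF i) _.
by apply: ler_surv_op => // j /=; [exact: surv_unit|exact: IH].
Qed.

(* Type 0 is junk: it is kept dead so that inequalities hold for all indices. *)
Definition positive_type i : R := (0 < i)%N%:R.

Lemma positive_type_unit : unit_vec positive_type.
Proof. by move=> i; rewrite ler0n lern1 leq_b1. Qed.

Definition alive phi n := surv phi positive_type n.

Lemma alive_unit phi n : unit_vec (alive phi n).
Proof. exact: surv_unit positive_type_unit. Qed.

Lemma aliveS_le phi n i : alive phi n.+1 i <= alive phi n i.
Proof.
elim: n i => [|n IH] /=.
  move=> [|i]; first by rewrite /alive /= surv_op_at0.
  rewrite [leRHS]/positive_type /=.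
  by have /andP[] := alive_unit phi 1 i.+1.
by apply: ler_surv_op => // i; [exact: alive_unit|exact: IH].
Qed.

(** Types move by at most one per generation, so no replacement is felt within [n] generations. *)
Lemma alive_local k n i : (i + n <= k)%N -> alive (minn k) n i = alive id n i.
Proof.
elim: n i => //= n IH i ink; rewrite /alive/= /surv_op /=.
have E j : (j <= i.+1)%N -> surv (minn k) positive_type n (minn k j)
    = surv id positive_type n j.
  move=> ji; have /minn_idPr -> : (j <= k)%N by lia.
  by apply: IH; lia.
by rewrite !E//; lia.
Qed.

Definition survival phi i : R := limn (fun n => alive phi n i).

Lemma is_cvg_alive phi i : cvgn (fun n => alive phi n i).
Proof.
apply: nonincreasing_is_cvgn.
  by apply/nonincreasing_seqP => n; exact: aliveS_le.
by exists 0 => _ [n _ <-]; have /andP[] := alive_unit phi n i.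
Qed.

Lemma cvg_alive phi i : alive phi n i @[n --> \oo] --> survival phi i.
Proof. exact: is_cvg_alive. Qed.

Lemma survival_le phi n i : survival phi i <= alive phi n i.
Proof.
apply: nonincreasing_cvgn_ge => //; last exact: is_cvg_alive.
by apply/nonincreasing_seqP => m; exact: aliveS_le.
Qed.

Lemma survival_ge phi (e : R) i : (forall n, e <= alive phi n i) -> e <= survival phi i.
Proof.
by move=> h; apply: limr_ge; [exact: is_cvg_alive|exact: nearW].
Qed.

Lemma survival_unit phi : unit_vec (survival phi).
Proof.
move=> i; rewrite survival_ge => [|n]; last by case/andP: (alive_unit phi n i).
by rewrite (le_trans (survival_le phi 0 i))//; case/andP: (positive_type_unit i).
Qed.

Lemma survival_at0 phi : survival phi 0%N = 0.
Proof.
apply/eqP; rewrite eq_le (le_trans (survival_le phi 0 0))//.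
by case/andP: (survival_unit phi 0).
Qed.

Lemma survival_fixed phi i : survival phi i = F (survival phi \o phi) i.
Proof.
apply/cvg_lim => //; rewrite -(cvg_shiftS (fun n => alive phi n i)).
have L m j : loss m (alive phi n j) @[n --> \oo] --> loss m (survival phi j).
  apply: cvgB; first exact: cvg_cst.
  have cvg1 : (1 - alive phi n j : R) @[n --> \oo] --> (1 - survival phi j : R).
    by apply: cvgB; [exact: cvg_cst|exact: cvg_alive].
  exact: (cvg_comp _ _ cvg1 (@exprn_continuous R m _)).
by apply: cvgD; (apply: cvgM; [exact: cvg_cst|exact: L]).
Qed.

(** The iteration starts above the subsolution [f] and is monotone, so it never drops below it.
    Every lower bound on the survival of replaced processes comes from here. *)
Lemma survival_le_sub phi f i : unit_vec f -> f 0%N = 0 ->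
  (forall i, f i <= F (f \o phi) i) -> f i <= survival phi i.
Proof.
move=> f01 f0 fF; apply: survival_ge => n; apply: surv_ge => //.
  exact: positive_type_unit.
move=> [|j]; first by rewrite f0.
by rewrite /positive_type; case/andP: (f01 j.+1).
Qed.

Lemma alive_near phi i (e : R) : 0 < e -> exists n, alive phi n i <= survival phi i + e.
Proof.
move=> e0; have /cvgrPdist_lt/(_ _ e0)[n _ /(_ n (leqnn n))/=] := @cvg_alive phi i.
by rewrite ltr_distlC => /andP[_ /ltW]; exists n.
Qed.

(** Survival up to a fixed generation is a finite-range event, on which the two processes agree for
    large [k]. *)
Lemma survival_minn_upper i (e : R) : 0 < e -> exists K, forall k, (K <= k)%N ->
  survival (minn k) i <= survival id i + e.
Proof.
move=> e0; have [n ne] := alive_near id i e0; exists (i + n)%N => k ink.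
by apply: le_trans (survival_le _ n _) _; rewrite alive_local.
Qed.

(** Far below [k] the replaced process follows the original one for [n] generations and then
    survives with probability at least [e]. So it dominates the iterates of the original operator
    started from the constant [e], and strict concavity pushes these up to [survival id]. [good]
    allows [k] to run along one parity only. *)
Lemma survival_minn_lower (good : pred nat) (e : R) K : 0 < e ->
  (forall n, exists2 k, (n <= k)%N & good k) ->
  (forall k i, (K <= k)%N -> good k -> (0 < i <= k)%N -> e <= survival (minn k) i) ->
  forall i (t : R), 0 < t -> exists K', forall k, (K' <= k)%N -> good k ->
  survival id i - t <= survival (minn k) i.
Proof.
move=> e0 goodI unif i t t0.
have e1 : e <= 1.
  have [k kK gk] := goodI K.+1.
  have := unif k 1%N (ltnW kK) gk (leq_ltn_trans (leq0n _) kK).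
  by move=> /le_trans; apply; case/andP: (survival_unit (minn k) 1).
(* The uniform bound passes to the original process through a good [k] too large to matter by
   generation [n]. *)
have Se j : (0 < j)%N -> e <= survival id j.
  move=> j0; apply: survival_ge => n.
  have [k] := goodI (K + (j + n))%N => kn gk.
  rewrite -(@alive_local k); last lia.
  apply: le_trans (survival_le _ _ _); apply: unif => //; lia.
have B0 : 1 <= B :> R by rewrite ler1n.
pose V n := surv id (fun j => e * positive_type j) n.
have V01 n : unit_vec (V n).
  apply: surv_unit => j; have /andP[p0 p1] := positive_type_unit j.
  by rewrite mulr_ge0 ?(ltW e0)//= mulr_ile1// ltW.
have VS n j k : (K <= k)%N -> good k -> (j + n <= k)%N -> V n j <= survival (minn k) j.
  move=> Kk gk; elim: n j => [|n IH] j jn.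
    case: j jn => [|j] jn; first by rewrite survival_at0 /V/= /positive_type /= mulr0.
    by rewrite /V /= /positive_type /= mulr1 unif//; lia.
  rewrite survival_fixed /V/= /surv_op /=.
  have E b : (b <= j.+1)%N -> surv id (fun j => e * positive_type j) n b
     <= survival (minn k) (minn k b) <= 1.
    move=> bj; have /minn_idPr -> : (b <= k)%N by lia.
    by rewrite IH /=; [case/andP: (survival_unit (minn k) b)|lia].
  by rewrite lerD// ler_wpM2l ?divr_ge0 ?mean_up_ge0 ?mean_down_ge0// ler_loss// E//; lia.
(* [th n * survival id] stays below the iterates of the constant [e], by concavity. *)
pose th n := iter n (fun x : R => x + x * (1 - x) * (e / B)) e.
have eB : 0 < e / B <= 1.
  have Bgt0 : 0 < B :> R by rewrite (lt_le_trans ltr01).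
  by rewrite divr_gt0//= ler_pdivrMr// mul1r (le_trans e1).
(* One iteration multiplies [1 - th n] by [1 - th n * (e / B)], which is at most [1 - e * (e / B)];
   hence [th n] tends to 1 geometrically. *)
have thP n : e <= th n <= 1 /\ 1 - th n <= (1 - e * (e / B)) ^+ n.
  case/andP: eB => eB0 eB1.
  elim: n => [|n [/andP[IH1 IH2] IH3]]; first by rewrite /= lexx e1 gerBl ltW.
  rewrite /th /=; rewrite -/(th n); move: (th n) IH1 IH2 IH3 => x x1 x2 x3.
  have x0 : 0 <= x by rewrite (le_trans (ltW e0)).
  have y0 : 0 <= 1 - x by rewrite subr_ge0.
  have E : 1 - (x + x * (1 - x) * (e / B)) = (1 - x * (e / B)) * (1 - x) by ring.
  split.
    rewrite (le_trans x1) /=; last by rewrite lerDl !mulr_ge0// ltW.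
    by rewrite -subr_ge0 E mulr_ge0// subr_ge0 mulr_ile1// ltW.
  rewrite E exprS ler_pM//; first by rewrite subr_ge0 mulr_ile1// ltW.
  by rewrite lerD2l lerN2 ler_wpM2r// ltW.
have thV n j : th n * survival id j <= V n j.
  elim: n j => [|n IH] j.
    rewrite /V /= ler_wpM2l ?(ltW e0)//.
    exact: (survival_le id 0).
  have [/andP[tn0 tn1] _] := thP n.
  rewrite survival_fixed; apply: le_trans (ler_surv_op _ _ _ (V01 n) (IH) j) => //.
  apply: surv_op_concave => //.
  - exact: survival_unit.
  - exact: ltW.
  - by rewrite tn1 (le_trans (ltW e0)).
have [||n nt] := @exprn_lt_small (1 - e * (e / B)) t.
- case/andP: eB => eB0 eB1.
  by rewrite subr_ge0 mulr_ile1 ?(ltW e0) ?(ltW eB0)//= gtrBl mulr_gt0.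
- by [].
exists (K + (i + n))%N => k Kk gk.
apply: (@le_trans _ _ (V n i)); last by apply: VS => //; lia.
apply: le_trans (thV n i).
have [/andP[tn0 tn1] /le_lt_trans/(_ nt)/ltW tn2] := thP n.
have /andP[s0 s1] := survival_unit id i.
have : 0 <= (1 - th n) * (1 - survival id i) by rewrite mulr_ge0 ?subr_ge0.
by lra.
Qed.

(** Let [C] be the largest ratio [f / w] up to [n]. If [C0 < C], then at a maximiser
    [f <= M f <= C * M w < C * w = f], a contradiction. The condition at [n.+1] is conditional so as
    to cover both a reflecting top, where [f n.+1 = f n], and a prescribed bound there. *)
Lemma max_principle n f w (C0 : R) : unit_vec f -> f 0%N = 0 -> 0 <= C0 ->
  (forall i, (0 < i)%N -> 0 < w i) -> w 0%N = 0 ->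
  (forall i, (0 < i <= n)%N -> f i <= M f i) ->
  (forall i, (0 < i <= n)%N -> M w i < w i) ->
  (forall C, C0 < C -> (forall i, (i <= n)%N -> f i <= C * w i) ->
     f n.+1 <= C * w n.+1) ->
  forall i, (i <= n)%N -> f i <= C0 * w i.
Proof.
move=> f01 f0 C00 wpos w0 fM Mw top i ilen.
have f_ge0 j : 0 <= f j by case/andP: (f01 j).
have [i1 _ max1] := @Order.TotalTheory.arg_maxP _ R 'I_n.+1 ord0 predT
  (fun j : 'I_n.+1 => f j / w j) isT.
set C := f i1 / w i1.
have fC j : (j <= n)%N -> f j <= C * w j.
  move=> jn; case: j jn => [|j] jn; first by rewrite f0 w0 mulr0.
  rewrite -ler_pdivrMr ?wpos//; exact: (max1 (Ordinal (jn : (j.+1 < n.+1)%N))).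
have [CC0|C0C] := leP C C0.
  apply: le_trans (fC i ilen) _; rewrite ler_wpM2r//.
  by case: i ilen => [|i] _; rewrite ?w0// ltW ?wpos.
(* The quotient at index 0 is 0, so a ratio above [C0] is attained at a genuine type. *)
have i1_gt0 : (0 < i1)%N.
  rewrite lt0n; apply/eqP => i10; move: C0C.
  by rewrite /C i10 f0 mul0r ltNge C00.
have i1n : (0 < i1 <= n)%N by rewrite i1_gt0 -ltnS ltn_ord.
have fC' j : (j <= n.+1)%N -> f j <= C * w j.
  by rewrite leq_eqVlt ltnS => /orP[/eqP ->|]; [exact: top|exact: fC].
have : f i1 < f i1.
  apply: le_lt_trans (fM _ i1n) _.
  apply: (@le_lt_trans _ _ (C * M w i1)).
    rewrite -mean_opZ /mean_op; have := ltn_ord i1 => i1n'.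
    by rewrite lerD// ler_wpM2l ?mean_up_ge0 ?mean_down_ge0// fC'//; lia.
  apply: (@lt_le_trans _ _ (C * w i1)).
    by rewrite ltr_pM2l ?Mw// (le_lt_trans C00).
  by rewrite /C divfK// gt_eqF ?wpos.
by rewrite ltxx.
Qed.

(** [A * w] is a supersolution of the Poisson equation with source [f], hence dominates the partial
    sums of the Green function. The induction peels off the term [n = 0] and bounds one application
    of the survival operator by the mean operator. *)
Lemma surv_sum_le f w (A : R) N i : unit_vec f ->
  0 <= A -> (forall i, f i + A * M w i <= A * w i) -> (forall i, 0 <= w i) ->
  \sum_(n < N) surv id f n i <= A * w i.
Proof.
move=> f01 A0 fw w0; elim: N i => [|N IH] i; first by rewrite big_ord0 mulr_ge0.
rewrite big_ord_recl /=; apply: le_trans (fw i); rewrite lerD2l -mean_opZ.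
apply: (@le_trans _ _ (M (fun j => \sum_(n < N) surv id f n j) i)); last exact: ler_mean_op.
rewrite /mean_op !mulr_sumr -big_split /=; apply: ler_sum => n _.
by apply: (surv_op_le_mean _ _ _ _ (@surv_unit id f n f01)).
Qed.

End Survival.

(** * Superharmonic functions *)

Section Superharmonic.
Context {R : realType} (a c d : R).
Hypotheses (a_gt0 : 0 < a) (c_gt0 : 0 < c) (d_gt1 : 1 < d).
Implicit Types (f g : nat -> R) (i n k : nat).
Local Notation F := (surv_op a c d).
Local Notation M := (mean_op a c d).
Local Notation B := (max_brood a c d)%:R.
Local Notation survival := (survival a c d).

Let d_gt0 : 0 < d. Proof. exact: lt_trans d_gt1. Qed.

Definition weight i : R := if odd i then d else 1.

Lemma weight_gt0 i : 0 < weight i.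
Proof. by rewrite /weight; case: ifP. Qed.

Lemma weight_ge1 i : 1 <= weight i.
Proof. by rewrite /weight; case: ifP => // _; exact: ltW. Qed.

Lemma weight_le i : weight i <= d.
Proof. by rewrite /weight; case: ifP => // _; exact: ltW. Qed.

(* The diagonal conjugation by weight turns the mean matrix into a homogeneous
   nearest-neighbour one. *)
Lemma mean_op_weight g i : g 0%N = 0 -> (0 < i)%N ->
  M (fun j => weight j * g j) i = weight i * (c * g i.+1 + a * g i.-1).
Proof.
have dn0 : d != 0 by rewrite gt_eqF.
move=> g0; case: i => [//|[|i]] _; rewrite /mean_op /mean_up /mean_down /weight /= ?g0;
  first by ring.
by rewrite !negbK; case: (odd i) => /=; field.
Qed.

Section Root.
Variable x : R.
Hypotheses (x_gt0 : 0 < x) (x_root : c * x ^+ 2 - x + a = 0).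

(* Any y < x with c y^2 - y + a > 0 would do; y < a suffices for the latter. *)
Let y := Num.min x a / 2.

(** The value 0 at index 0 accounts for the downward births that type 1 does not have. *)
Definition superg i := x ^+ i - y ^+ i.
Definition superw i := weight i * superg i.

Let y_gt0 : 0 < y. Proof. by rewrite divr_gt0// lt_min x_gt0. Qed.
Let y_ltx : y < x.
Proof.
rewrite ltr_pdivrMr//; have : Num.min x a <= x by rewrite ge_min lexx.
by move/le_lt_trans; apply; rewrite ltr_pMr// ltr1n.
Qed.
Let y_lta : y < a.
Proof.
rewrite ltr_pdivrMr//; have : Num.min x a <= a by rewrite ge_min lexx orbT.
by move/le_lt_trans; apply; rewrite ltr_pMr// ltr1n.
Qed.

Lemma superg0 : superg 0%N = 0. Proof. by rewrite /superg !expr0 subrr. Qed.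

Lemma superw0 : superw 0%N = 0. Proof. by rewrite /superw superg0 mulr0. Qed.

Lemma superg_gt0 i : (0 < i)%N -> 0 < superg i.
Proof. by move=> i0; rewrite subr_gt0 ltrXn2r ?ltW// -lt0n. Qed.

Lemma superw_gt0 i : (0 < i)%N -> 0 < superw i.
Proof. by move=> i0; rewrite mulr_gt0 ?weight_gt0 ?superg_gt0. Qed.

Lemma superw_ge0 i : 0 <= superw i.
Proof. by case: i => [|i]; rewrite ?superw0// ltW// superw_gt0. Qed.

Lemma superg_growth i : x * superg i <= superg i.+1.
Proof. by rewrite /superg !exprS mulrBr lerD2l lerN2 ler_wpM2r ?exprn_ge0 ?ltW. Qed.

(** Powers of the root [x] are harmonic after conjugation, so the gap is the weight times
    [y ^+ i.-1 * (c * y ^+ 2 - y + a)], positive because [y < a]. *)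
Lemma mean_op_superw i : (0 < i)%N -> M superw i < superw i.
Proof.
move=> i0; rewrite mean_op_weight ?superg0// /superw ltr_pM2l ?weight_gt0//.
case: i i0 => // i _; rewrite /superg /= !exprS.
have : 0 < y ^+ i * (c * y ^+ 2 - y + a).
  rewrite mulr_gt0 ?exprn_gt0// -addrA ltr_wpDl//; last by rewrite addrC subr_gt0.
  by rewrite mulr_ge0 ?sqr_ge0// ltW.
have : x ^+ i * (c * x ^+ 2 - x + a) = 0 by rewrite x_root mulr0.
by move: (x ^+ i) (y ^+ i) => u v; rewrite !expr2; lra.
Qed.

(** The maximum principle with [C0 = 0]: retyping makes the survival function equal at [k] and
    [k.+1], and the hypothesis says that [superw] does not decrease there. *)
Lemma survival_minn_eq0 k i :
  weight k * superg k <= weight k.+1 * superg k.+1 -> (i <= k)%N -> survival (minn k) i = 0.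
Proof.
move=> top ik; apply/eqP; rewrite eq_le; case/andP: (survival_unit a_gt0 c_gt0 d_gt1
  (minn k) i) => -> _.
rewrite andbT; pose f := survival (minn k) \o minn k.
have f01 : unit_vec f by move=> j; exact: survival_unit.
have mp := @max_principle _ a c d a_gt0 c_gt0 d_gt1 k f superw 0 f01.
have -> : survival (minn k) i = f i by rewrite /f /=; move/minn_idPr: ik => ->.
rewrite -[X in _ <= X](mul0r (superw i)); apply: mp => //.
- by rewrite /f /= minn0 survival_at0.
- exact: superw_gt0.
- exact: superw0.
- move=> j /andP[j0 jk]; apply: le_trans (surv_op_le_mean a_gt0 c_gt0 d_gt1 j f01).
  by rewrite {1}/f /=; move/minn_idPr: jk => ->; rewrite survival_fixed.
- by move=> j /andP[j0 _]; exact: mean_op_superw.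
- move=> C C0 fC; have -> : f k.+1 = f k.
    by rewrite /f /= minnn (minn_idPl _).
  by apply: le_trans (fC k (leqnn k)) _; rewrite ler_wpM2l// ltW.
Qed.

(** For [x > 1], [superw] grows geometrically while survival stays below 1. Comparison up to a high
    level [m], with [C0] the inverse of [superw m], gives [survival id i <= superw i / superw m]. *)
Lemma survival_eq0_gt1 i : 1 < x -> survival id i = 0.
Proof.
move=> x1; have f01 := survival_unit a_gt0 c_gt0 d_gt1 id.
apply/eqP; rewrite eq_le; case/andP: (f01 i) => -> _; rewrite andbT.
have g1 : 0 < superg 1 by exact: superg_gt0.
have growth n : x ^+ n * superg 1 <= superw n.+1.
  apply: (@le_trans _ _ (superg n.+1)).
    elim: n => [|n IH]; first by rewrite mul1r.
    by apply: le_trans (superg_growth _); rewrite exprS -mulrA ler_pM2l.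
  by rewrite ler_peMl ?weight_ge1// ltW// superg_gt0.
apply/ler_addgt0Pr => e e0; rewrite add0r.
have [||n nsmall] := @exprn_lt_small _ x^-1 (e * superg 1 / (superw i + 1)).
- by rewrite invr_ge0 ltW//= invf_lt1.
- by rewrite divr_gt0 ?mulr_gt0// ltr_wpDl// superw_ge0.
have wn0 m : 0 < superw m.+1 by rewrite superw_gt0.
apply: (@le_trans _ _ ((superw (n + i).+1)^-1 * superw i)).
  apply: (@max_principle _ a c d a_gt0 c_gt0 d_gt1 (n + i) _ superw) => //.
  - exact: survival_at0.
  - by rewrite invr_ge0 ltW.
  - exact: superw_gt0.
  - exact: superw0.
  - move=> j _; apply: le_trans (surv_op_le_mean a_gt0 c_gt0 d_gt1 j f01).
    by rewrite {1}survival_fixed.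
  - by move=> j /andP[j0 _]; exact: mean_op_superw.
  - move=> C C0 _; apply: (@le_trans _ _ 1); first by case/andP: (f01 (n + i).+1).
    by rewrite -ler_pdivrMr// mul1r ltW.
  - exact: leq_addl.
rewrite ler_pdivrMl//.
move: nsmall; rewrite exprVn ltr_pdivlMr ?ltr_wpDl ?superw_ge0// ltr_pdivrMl ?exprn_gt0//.
move=> h; apply: le_trans (_ : superw i + 1 <= _); first by rewrite lerDl.
apply: le_trans (ltW h) _; rewrite mulrCA mulrC ler_pM2r//.
apply: le_trans (growth _); rewrite ler_pM2r// ler_weXn2l ?leq_addr// ltW//.
Qed.

(** Expected visits to [l]: the constant is the inverse of the superharmonicity gap of [superw] at
    [l], which makes the source at [l] absorbable. *)
Lemma surv_sum_bounded l : (0 < l)%N -> exists A : R, forall N i,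
  \sum_(n < N) surv a c d id (fun j => (j == l)%:R) n i <= A * superw i.
Proof.
move=> l0; have wl : 0 < superw l - M superw l by rewrite subr_gt0 mean_op_superw.
exists (superw l - M superw l)^-1 => N i.
apply: surv_sum_le => //.
- by move=> j; rewrite ler0n lern1 leq_b1.
- by rewrite invr_ge0 ltW.
- move=> j; rewrite -lerBrDr -mulrBr; case: eqP => [->|_].
    by rewrite mulVf// gt_eqF.
  rewrite mulr_ge0 ?invr_ge0 ?(ltW wl)// subr_ge0.
  case: j => [|j]; first by rewrite mean_op_at0 superw0.
  by rewrite ltW// mean_op_superw.
- exact: superw_ge0.
Qed.

End Root.

(* Critical case: a bounded solution of [f <= F f] contracts by a quadratic
   amount against the supersolution weight. *)
Lemma survival_eq0_eq1 i : c + a = 1 -> survival id i = 0.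
Proof.
move=> ca1; have f01 := survival_unit a_gt0 c_gt0 d_gt1 id.
pose h j := weight j * (0 < j)%N%:R.
have Mh j : (0 < j)%N -> M h j = weight j * (c + a * (1 < j)%N%:R).
  by move=> j0; rewrite mean_op_weight ?mulr1//; case: j j0 => [|[|j]].
have h1 j : (0 < j)%N -> 1 <= h j by move=> j0; rewrite /h j0 mulr1 weight_ge1.
have hd j : h j <= d.
  by rewrite /h; case: j => [|j] /=; rewrite ?mulr0 ?mulr1 ?weight_le// ltW.
have h0 : h 0%N = 0 by rewrite /h /= mulr0.
have h_ge0 j : 0 <= h j by rewrite mulr_ge0// ltW// weight_gt0.
(* The first entry is the quadratic loss available at types above 1, the second the deficit at type
   1. *)
pose kap := Num.min (1 / (d ^+ 2 * B)) a.
have B1 : 1 <= B :> R by rewrite ler1n.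
have Bgt0 : 0 < B :> R by rewrite (lt_le_trans ltr01).
have kap_gt0 : 0 < kap by rewrite lt_min a_gt0 divr_gt0// mulr_gt0 ?exprn_gt0.
have kap_lea : kap <= a by rewrite ge_min lexx orbT.
have kap_le1 : kap <= 1 by rewrite (le_trans kap_lea)// -ca1 lerDr ltW.
(* The best constant [m] in [survival id <= C * h] is attained. It can be improved to
   [m - kap * m ^+ 2], which forces [m = 0]. *)
pose A := [set C : R | 0 <= C <= 1 /\ forall j, survival id j <= C * h j].
have A1 : A 1.
  split=> [|[|j]]; rewrite ?ler01 ?lexx ?survival_at0 ?h0 ?mulr0 ?mul1r//.
  by apply: le_trans (h1 j.+1 isT); case/andP: (f01 j.+1).
have lbA : has_lbound A by exists 0 => C [/andP[]].
have infA : has_inf A by split=> //; exists 1.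
set m := inf A.
have m0 : 0 <= m by apply: lb_le_inf; [exists 1|move=> C [/andP[]]].
have m1 : m <= 1 by apply: ge_inf.
have Am : A m.
  split=> [|j]; first by rewrite m0 m1.
  case: j => [|j]; first by rewrite survival_at0 // h0 mulr0.
  rewrite -ler_pdivrMr ?(lt_le_trans ltr01 (h1 _ _))//.
  apply: lb_le_inf; first by exists 1.
  move=> C [_ /(_ j.+1)].
  by rewrite ler_pdivrMr ?(lt_le_trans ltr01 (h1 _ _)).
have Am' : A (m - kap * m ^+ 2).
  have km : 0 <= 1 - kap * m by rewrite subr_ge0 mulr_ile1// ltW.
  split=> [|j].
    rewrite (le_trans _ m1) ?gerBl ?mulr_ge0 ?sqr_ge0 ?(ltW kap_gt0)// andbT.
    by rewrite (_ : _ - _ = m * (1 - kap * m)) ?mulr_ge0//; ring.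
  case: j => [|[|j]]; first by rewrite survival_at0 // h0 mulr0.
    (* At type 1 no downward birth occurs, so the mean of [h] is only [c * h 1 = (1 - a) * h 1]. *)
    rewrite survival_fixed//.
    apply: le_trans (surv_op_le_mean a_gt0 c_gt0 d_gt1 _ f01) _.
    apply: (@le_trans _ _ (M (fun j => m * h j) 1)).
      by apply: ler_mean_op => // j'; case: Am.
    rewrite mean_opZ Mh// ltnn /h /= mulr0n mulr0 addr0 mulr1 mulrCA [leRHS]mulrC
      ler_pM2l ?weight_gt0//.
    have -> : m - kap * m ^+ 2 = m * (1 - kap * m) by ring.
    rewrite ler_wpM2l// -ca1 -addrA lerDl subr_ge0.
    by rewrite (le_trans (_ : _ <= kap)) ?ler_piMr// ltW.
  rewrite survival_fixed//.
  apply: le_trans (surv_op_le_quadratic a_gt0 c_gt0 d_gt1 j.+2 f01) _.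
  set b := (brood a c d j.+2)%:R; have b0 : 0 < b by exact: brood_gt0.
  have b2 : 2 <= b by rewrite ler_nat brood_gt1.
  (* [b t - t^2 / d^2] is nondecreasing for [t <= d]. *)
  have L j' : (0 < j')%N -> b * survival id j' - survival id j' ^+ 2 <=
     b * (m * h j') - (m ^+ 2 / (d ^+ 2 * B)) * (b * h j').
    move=> j'0; have [_ /(_ j')] := Am; have /andP[] := f01 j'.
    move: (survival id j') => s s0 s1 sm.
    apply: (@le_trans _ _ (b * (m * h j') - (m * h j') ^+ 2 / d ^+ 2)).
      have s2 : s ^+ 2 / d ^+ 2 <= s ^+ 2.
        by rewrite ler_pdivrMr ?exprn_gt0// ler_peMr ?sqr_ge0// exprn_ege1// ltW.
      have mhd : m * h j' <= d by rewrite -[d]mul1r ler_pM.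
      have : 0 <= (m * h j' - s) * (b - (m * h j' + s) / d ^+ 2).
        rewrite mulr_ge0 ?subr_ge0// (le_trans _ b2)// ler_pdivrMr ?exprn_gt0//.
        have : d <= d ^+ 2 by rewrite expr2 ler_peMr// ltW.
        by move: (d ^+ 2) => D ? ; have := le_trans sm mhd; lra.
      have -> : (m * h j' - s) * (b - (m * h j' + s) / d ^+ 2) =
        b * (m * h j') - (m * h j') ^+ 2 / d ^+ 2 - (b * s - s ^+ 2 / d ^+ 2).
        by field; rewrite gt_eqF.
      rewrite subr_ge0; apply: le_trans; by rewrite lerD2l lerN2.
    (* The square of [h j'] is made linear by [b / B <= 1 <= h j']. *)
    rewrite lerD2l lerN2 exprMn invfM.
    have -> : m ^+ 2 * ((d ^+ 2)^-1 / B) * (b * h j') =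
      m ^+ 2 / d ^+ 2 * (b / B * h j') by ring.
    rewrite [leRHS]mulrAC ler_wpM2l ?mulr_ge0 ?invr_ge0 ?sqr_ge0//.
    rewrite expr2 ler_wpM2r// (le_trans _ (h1 _ j'0))// ler_pdivrMr// mul1r.
    by rewrite ler_nat brood_le.
  have E g : M g j.+2 - (mean_up c d j.+2 / b * g j.+3 ^+ 2 + mean_down a d j.+2 / b * g
    j.+1 ^+ 2)
     = mean_up c d j.+2 / b * (b * g j.+3 - g j.+3 ^+ 2)
     + mean_down a d j.+2 / b * (b * g j.+1 - g j.+1 ^+ 2).
    by rewrite /mean_op /=; field; rewrite gt_eqF.
  rewrite E; apply: (@le_trans _ _ ((m - m ^+ 2 / (d ^+ 2 * B)) * M h j.+2)).
    rewrite /mean_op [leRHS]mulrDr lerD//.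
      rewrite [leRHS](_ : _ = mean_up c d j.+2 / b * (b * (m * h j.+3) - (m ^+ 2 / (d ^+
        2 * B)) * (b * h j.+3))).
        by rewrite ler_wpM2l ?divr_ge0 ?mean_up_ge0 ?L// ltW.
      by field; rewrite !gt_eqF.
    rewrite [leRHS](_ : _ = mean_down a d j.+2 / b * (b * (m * h j.+1) - (m ^+ 2 / (d ^+
      2 * B)) * (b * h j.+1))).
      by rewrite ler_wpM2l ?divr_ge0 ?mean_down_ge0 ?L// ltW.
    by field; rewrite !gt_eqF.
  rewrite Mh// mulr1 ca1 /h /= ler_wpM2r ?mulr1 ?(ltW (weight_gt0 _))//.
  rewrite lerD2l lerN2 [leLHS]mulrC ler_wpM2l ?sqr_ge0//.
  by rewrite ge_min div1r lexx.
have : m <= m - kap * m ^+ 2 by apply: ge_inf.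
rewrite lerDl oppr_ge0 pmulr_rle0// => m2.
have m20 : m = 0 by apply/eqP; rewrite -sqrf_eq0 eq_le m2 sqr_ge0.
apply/eqP; rewrite eq_le; case/andP: (f01 i) => -> _; rewrite andbT.
by have [_ /(_ i)] := Am; rewrite m20 mul0r.
Qed.

End Superharmonic.

(** * Subharmonic functions *)

Section Subharmonic.
Context {R : realType} (a c d : R).
Hypotheses (a_gt0 : 0 < a) (c_gt0 : 0 < c) (d_gt1 : 1 < d).
Implicit Types (f g h : nat -> R) (i n k : nat).
Local Notation F := (surv_op a c d).
Local Notation M := (mean_op a c d).
Local Notation B := (max_brood a c d)%:R.
Local Notation survival := (survival a c d).
Local Notation weight := (weight d).

Let d_gt0 : 0 < d. Proof. exact: lt_trans d_gt1. Qed.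
Let weight_gt0 i : 0 < weight i. Proof. exact: weight_gt0. Qed.
Let B_ge1 : 1 <= B :> R. Proof. by rewrite ler1n. Qed.
Let B_gt0 : 0 < B :> R. Proof. by rewrite ltr0n. Qed.

Lemma scaled_unit h (H gam eta : R) : (forall j, 0 <= h j <= H) -> 0 < gam -> 0 <= eta ->
  eta * (B * H * (1 + gam)) <= gam -> unit_vec (fun j => eta * h j).
Proof.
move=> h0 gam0 eta0 etaH j; have /andP[hj0 hjH] := h0 j.
have H0 : 0 <= H by exact: le_trans hjH.
rewrite mulr_ge0//=; apply: (@le_trans _ _ (eta * (B * H))).
  by rewrite ler_wpM2l// (le_trans hjH)// ler_peMl.
have g1 : 0 < 1 + gam by rewrite addr_gt0.
rewrite -(ler_pM2r g1) -mulrA (le_trans etaH)// mul1r lerDr//.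
Qed.

(** The nonlinearity costs at most a factor [1 - B * eta * H]; the condition on [eta] says exactly
    that the growth factor [1 + gam] of [h] compensates it. *)
Lemma scaled_sub h (H gam eta : R) phi i : (forall j, 0 <= h j <= H) -> 0 < gam ->
  0 <= eta -> eta * (B * H * (1 + gam)) <= gam ->
  (1 + gam) * h i <= M (h \o phi) i -> eta * h i <= F ((fun j => eta * h j) \o phi) i.
Proof.
move=> h0 gam0 eta0 etaH hM.
have u := scaled_unit h0 gam0 eta0 etaH.
have hH j : eta * h (phi j) <= eta * H.
  by rewrite ler_wpM2l//; case/andP: (h0 (phi j)).
apply: le_trans (surv_op_ge a_gt0 c_gt0 d_gt1 i (f := (fun j => eta * h j) \o phi) (fun j
  => u (phi j)) hH).
rewrite (mean_opZ a c d eta (h \o phi)).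
have g1 : 0 < 1 + gam by rewrite addr_gt0.
have e1 : 1 <= (1 - B * (eta * H)) * (1 + gam).
  have -> : (1 - B * (eta * H)) * (1 + gam) = 1 + gam - eta * (B * H * (1 + gam)) by ring.
  by rewrite -addrA lerDl subr_ge0.
have e0 : 0 <= 1 - B * (eta * H) by rewrite -(pmulr_lge0 _ g1) (le_trans ler01).
rewrite mulrCA ler_wpM2l//; apply: le_trans (_ : (1 - B * (eta * H)) * ((1 + gam) * h i)
  <= _).
  by rewrite [leRHS]mulrA ler_peMl//; case/andP: (h0 i).
by rewrite ler_wpM2l.
Qed.

(** A parabola vanishing at both ends of a window, times a geometric sequence of ratio [rho] chosen
    so that [c * rho] and [a / rho] both exceed 1/2. The window may sit anywhere, with [N] and [e]
    independent of its position [o]. *)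
Lemma block_sub : 1 / 4 < a * c -> exists N (e : R), [/\ (1 < N)%N, 0 < e &
  forall o, exists f, [/\ unit_vec f, f 0%N = 0, forall i, (o + N <= i)%N -> f i = 0,
    forall i, (o < i < o + N)%N -> e <= f i & forall i, f i <= F f i]].
Proof.
(* The midpoint of [1 / (2 * c)] and [2 * a], which are in this order exactly when
   [a * c > 1 / 4]. *)
move=> ac; pose rho := (1 / (2 * c) + 2 * a) / 2.
have rho_gt0 : 0 < rho by rewrite !(divr_gt0, addr_gt0, mulr_gt0).
pose kap := Num.min (c * rho) (a / rho).
have kap1 : 1 < 2 * kap.
  rewrite -ltr_pdivrMl// mulr1 lt_min; apply/andP; split.
    have -> : c * rho = 1 / 4 + a * c by rewrite /rho; field; rewrite gt_eqF.
    by lra.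
  rewrite ltr_pdivlMr// mulrC ltr_pdivrMr// /rho.
  have : 1 / (2 * c) < 2 * a.
    by rewrite ltr_pdivrMr ?mulr_gt0//; lra.
  by lra.
have kapc : kap <= c * rho by rewrite ge_min lexx.
have kapa : kap * rho <= a by rewrite -ler_pdivlMr// ge_min lexx orbT.
pose gam := (2 * kap - 1) / 2.
have gam_gt0 : 0 < gam by rewrite divr_gt0// subr_gt0.
(* Inside the window the parabola is at least [N - 1], so [gam] times it then pays for its constant
   second difference, which costs [2 * kap]. *)
have [N [N1 NP]] : exists N, (1 < N)%N /\ 2 * kap / gam <= N.-1%:R.
  exists (ceiln (2 * kap / gam)).+2; split=> //=.
  apply: (@le_trans _ _ (ceiln (2 * kap / gam))%:R); last by rewrite ler_nat.
  by apply: le_ceiln; rewrite divr_ge0 ?(ltW gam_gt0)// (le_trans _ (ltW kap1)).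
pose H := d * (1 + rho) ^+ N * (N * N)%:R.
have r1 : 1 <= 1 + rho by rewrite lerDl ltW.
have H_gt0 : 0 < H by rewrite mulr_gt0 ?ltr0n ?muln_gt0 ?(ltnW N1)// mulr_gt0//
  exprn_gt0// addr_gt0.
pose eta := gam / (B * H * (1 + gam)).
have BHg : 0 < B * H * (1 + gam) by exact: (mulr_gt0 (mulr_gt0 B_gt0 H_gt0) (addr_gt0
  ltr01 gam_gt0)).
have eta_gt0 : 0 < eta by rewrite divr_gt0.
have etaP : eta * (B * H * (1 + gam)) <= gam by rewrite divfK// gt_eqF.
(* [m ^+ N] bounds [rho ^+ j] from below for all [j <= N], whether or not [rho < 1]. *)
pose m := Num.min rho 1.
have m_gt0 : 0 < m by rewrite lt_min rho_gt0 ltr01.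
exists N, (eta * m ^+ N); split=> //; first by rewrite mulr_gt0 ?exprn_gt0.
move=> o; pose g i : R := rho ^+ (i - o) * ((i - o) * (o + N - i))%:R.
pose h i := weight i * g i.
have g0 i : 0 <= g i by rewrite mulr_ge0// exprn_ge0// ltW.
have gz i : (i <= o)%N || (o + N <= i)%N -> g i = 0.
  move=> hi; rewrite /g (_ : ((i - o) * (o + N - i))%N = 0%N) ?mulr0//.
  by apply/eqP; rewrite muln_eq0 !subn_eq0.
have h0H i : 0 <= h i <= H.
  rewrite mulr_ge0 ?(ltW (weight_gt0 _))//=.
  have [hi|] := boolP ((i <= o)%N || (o + N <= i)%N).
    by rewrite /h gz// mulr0 ltW.
  rewrite negb_or -!ltnNge => /andP[oi iN].
  rewrite /H -mulrA ler_pM ?(ltW (weight_gt0 _))// ?weight_le//.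
  rewrite /g ler_pM ?exprn_ge0 ?(ltW rho_gt0)//.
    apply: (@le_trans _ _ ((1 + rho) ^+ (i - o))).
      by rewrite lerXn2r ?nnegrE ?addr_ge0 ?(ltW rho_gt0)// lerDr.
    by rewrite ler_weXn2l//; clear -oi iN; lia.
  by rewrite ler_nat leq_mul//; clear -oi iN; lia.
exists (fun j => eta * h j); split.
- exact: scaled_unit h0H gam_gt0 (ltW eta_gt0) etaP.
- by rewrite /h gz// mulr0 mulr0.
- by move=> i hi; rewrite /h gz ?hi ?orbT// mulr0 mulr0.
- move=> i /andP[oi iN]; rewrite ler_pM2l//.
  apply: (@le_trans _ _ (g i)); last by rewrite ler_peMl ?weight_ge1.
  apply: (@le_trans _ _ (m ^+ (i - o))).
    have m1 : 0 <= m <= 1 by rewrite ltW//= ge_min lexx orbT.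
    by case/andP: m1 => m0 m1; rewrite ler_wiXn2l//; clear -oi iN; lia.
  apply: (@le_trans _ _ (rho ^+ (i - o))).
    by rewrite lerXn2r ?nnegrE ?(ltW rho_gt0) ?(ltW m_gt0)// ge_min lexx.
  by rewrite ler_peMr ?exprn_ge0 ?(ltW rho_gt0)// ler1n muln_gt0 !subn_gt0 oi.
- move=> i; apply: (scaled_sub (phi := id) h0H gam_gt0 (ltW eta_gt0) etaP).
  case: i => [|i]; first by rewrite mean_op_at0 /h gz// !mulr0.
  rewrite [leRHS](@mean_op_weight _ a c d d_gt1 g i.+1 (gz 0%N isT) isT) /h mulrCA
    ler_pM2l//=.
  have [hi|] := boolP ((i.+1 <= o)%N || (o + N <= i.+1)%N).
    by rewrite gz// mulr0 addr_ge0// mulr_ge0// ltW.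
  rewrite negb_or -!ltnNge => /andP[oi iN].
  (* The type [i.+1] lies at distance [j.+1] from the left end and [l.+1] from the right end; the
     second difference reads [j.+2 * l + j * l.+2 = 2 * (j.+1 * l.+1) - 2]. *)
  have [j Ej] : exists j, i = (o + j)%N by exists (i - o)%N; clear -oi; lia.
  have [l El] : exists l, N = (j + l.+2)%N by exists (N - j - 2)%N; clear -Ej oi iN; lia.
  rewrite /g El Ej.
  rewrite (_ : ((o + j).+1 - o = j.+1)%N); last by clear; lia.
  rewrite (_ : ((o + j).+2 - o = j.+2)%N); last by clear; lia.
  rewrite (_ : (o + j - o = j)%N); last by clear; lia.
  rewrite (_ : (o + (j + l.+2) - (o + j).+1 = l.+1)%N); last by clear; lia.
  rewrite (_ : (o + (j + l.+2) - (o + j).+2 = l)%N); last by clear; lia.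
  rewrite (_ : (o + (j + l.+2) - (o + j) = l.+2)%N); last by clear; lia.
  have b2 : 2 * kap <= gam * (j.+1 * l.+1)%:R.
    rewrite [leRHS]mulrC -ler_pdivrMr// (le_trans NP)// ler_nat.
    by rewrite El; clear; nia.
  have b1 : (1 + gam) * (j.+1 * l.+1)%:R <= kap * (j.+2 * l)%:R + kap * (j * l.+2)%:R.
    have -> : kap * (j.+2 * l)%:R + kap * (j * l.+2)%:R =
      2 * kap * (j.+1 * l.+1)%:R - 2 * kap.
      by rewrite !natrM -!natr1; ring.
    have : 2 * kap = 1 + 2 * gam by rewrite /gam; field.
    move: ((j.+1 * l.+1)%:R : R) b2 => b; move: (2 * kap) => kk b2 kkE; rewrite kkE in b2 *.
    by lra.
  have rj : 0 <= rho ^+ j * rho by rewrite mulr_ge0 ?exprn_ge0// ltW.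
  rewrite !exprS.
  have := ler_wpM2l rj b1.
  have c1 : kap * (rho ^+ j * rho * (j.+2 * l)%:R) <= c * rho * (rho ^+ j * rho * (j.+2 *
    l)%:R).
    by apply: ler_wpM2r kapc; apply: mulr_ge0.
  have c2 : kap * rho * (rho ^+ j * (j * l.+2)%:R) <= a * (rho ^+ j * (j * l.+2)%:R).
    by apply: ler_wpM2r kapa; rewrite mulr_ge0// exprn_ge0// ltW.
  by lra.
Qed.

Lemma survival_minn_ge_supercritical : 1 / 4 < a * c -> exists (K : nat) (e : R),
  0 < e /\ forall k i, (K <= k)%N -> (0 < i <= k)%N -> e <= survival (minn k) i.
Proof.
(* The window contains [i] and ends by [k.+1], where its function is already 0; hence precomposing
   with [minn k] can only increase it. *)
move=> /block_sub[N [e [N1 e0 blk]]]; exists N, e; split=> // k i Nk /andP[i0 ik].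
pose o := minn i.-1 (k.+1 - N).
have [f [f01 f0 fN fe fF]] := blk o.
apply: le_trans (_ : f i <= _); first by apply: fe; rewrite /o; lia.
apply: survival_le_sub => // j; apply: le_trans (fF j) _.
apply: ler_surv_op => // j'; first exact: f01.
rewrite /= /minn; case: ltnP => // kj; rewrite fN; first by case/andP: (f01 k).
by rewrite /o; lia.
Qed.

(* [D] is the factor by which replacing [k+1] by [k] rescales [g k] into a virtual [g k.+1]. *)
Lemma mean_op_weight_minn g (D : R) k i : weight k = D * weight k.+1 -> g 0%N = 0 -> (0 <
  i <= k)%N ->
  M ((fun j => weight j * g j) \o minn k) i =
  weight i * (c * (if (i < k)%N then g i.+1 else D * g k) + a * g i.-1).
Proof.
move=> lD g0 /andP[i0 ik]; pose g' j := if (j <= k)%N then g j else D * g k.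
have g'0 : g' 0%N = 0 by rewrite /g'.
have <- : M (fun j => weight j * g' j) i = M ((fun j => weight j * g j) \o minn k) i.
  rewrite /mean_op /=; congr (_ * _ + _ * _).
    rewrite /g'; case: ltnP => ik'; first by rewrite (minn_idPr _).
    have -> : i = k by lia.
    by rewrite (minn_idPl _)// lD; ring.
  by rewrite /g' (_ : (i.-1 <= k)%N) ?(minn_idPr _)//; lia.
rewrite mean_op_weight// /g' (_ : (i.-1 <= k)%N)//; lia.
Qed.

Section Root.
Variable x : R.
Hypotheses (x_gt0 : 0 < x) (x_root : c * x ^+ 2 - x + a = 0) (x_large : 1 <= 2 * c * x).

(** [x_large] makes [x] the larger root. *)
Lemma root_poly_gt0 y : x < y -> 0 < c * y ^+ 2 - y + a.
Proof.
move=> xy; have -> : c * y ^+ 2 - y + a = (y - x) * (c * (y + x) - 1).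
  by rewrite -[LHS]subr0 -x_root; ring.
rewrite mulr_gt0 ?subr_gt0// (le_lt_trans x_large)//.
by have := ltr_pM2l c_gt0 x y; rewrite xy; lra.
Qed.

(** Below the top, [1 - x ^+ j] is strictly subharmonic since [c + a > 1]. At the top it is relayed
    by [y ^+ j - x ^+ j], counted from [o = k - L], which remains subharmonic at [k] because
    [y < D]. The maximum of suitable multiples of the two is a subsolution everywhere. *)
Lemma survival_minn_ge_local (D : R) : x < 1 -> x < D -> exists (K : nat) (e : R),
  0 < e /\ forall k i, (K <= k)%N -> weight k = D * weight k.+1 -> (0 < i <= k)%N ->
  e <= survival (minn k) i.
Proof.
move=> x1 xD; pose y := (x + Num.min D 1) / 2.
have xm : x < Num.min D 1 by rewrite lt_min xD x1.
have xy : x < y by rewrite /y; lra.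
have [yD y1] : y < D /\ y < 1.
  have [h1 h2] : Num.min D 1 <= D /\ Num.min D 1 <= 1 by rewrite !ge_min !lexx orbT.
  by rewrite /y; split; lra.
have y_gt0 : 0 < y := lt_trans x_gt0 xy.
pose gam1 := (c * y ^+ 2 - y + a) / y.
have gam1_gt0 : 0 < gam1 by rewrite divr_gt0// root_poly_gt0.
pose gam2 := c + a - 1.
have gam2_gt0 : 0 < gam2 by have := root_poly_gt0 x1; rewrite /gam2 expr1n; lra.
have Dy : 0 < D - y by rewrite subr_gt0.
have Dx : 0 < D - x by rewrite subr_gt0.
(* Rearranging [(x / y) ^+ L < (D - y) / (D - x)] gives [top]: the virtual value at [k.+1] exceeds
   the natural continuation of [y ^+ j - x ^+ j]. *)
have [||L LP] := @exprn_lt_small _ (x / y) ((D - y) / (D - x)).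
- by rewrite divr_ge0 ?ltW// ?ltr_pdivrMr// mul1r.
- by rewrite divr_gt0.
have top : y ^+ L.+1 - x ^+ L.+1 <= D * (y ^+ L - x ^+ L).
  move: LP; rewrite expr_div_n ltr_pdivrMr ?exprn_gt0// mulrAC ltr_pdivlMr// !exprS.
  by lra.
have L_gt0 : (0 < L)%N.
  rewrite lt0n; apply/eqP => L0; move: LP; rewrite L0 expr0 ltr_pdivlMr// mul1r.
  by lra.
have Bd : 0 < B * d :> R by rewrite mulr_gt0.
pose eta1 := gam1 / (B * d * (1 + gam1)).
pose gL := y ^+ L - x ^+ L.
have gL_gt0 : 0 < gL by rewrite subr_gt0 ltrXn2r// ?ltW// -lt0n.
(* The second entry makes the top piece dominate at [k]. *)
pose eta2 := Num.min (gam2 / (B * d * (1 + gam2))) (eta1 * gL).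
have eta1_gt0 : 0 < eta1 by rewrite divr_gt0// mulr_gt0// addr_gt0.
have eta2_gt0 : 0 < eta2.
  by rewrite lt_min (mulr_gt0 eta1_gt0 gL_gt0) andbT divr_gt0// mulr_gt0// addr_gt0.
have P1 : 0 < B * d * (1 + gam1) by rewrite mulr_gt0// addr_gt0.
have P2 : 0 < B * d * (1 + gam2) by rewrite mulr_gt0// addr_gt0.
have eta1P : eta1 * (B * d * (1 + gam1)) <= gam1.
  by rewrite divfK// gt_eqF// mulr_gt0// addr_gt0.
have eta2P : eta2 * (B * d * (1 + gam2)) <= gam2.
  by rewrite -ler_pdivlMr// ge_min lexx.
exists L, (eta2 * (1 - x)); split; first by rewrite mulr_gt0// subr_gt0.
move=> k i Lk lD ik; pose o := (k - L)%N.
pose g1 j : R := if (j <= k)%N then y ^+ (j - o) - x ^+ (j - o) else 0.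
pose g2 j : R := 1 - x ^+ j.
pose h1 j := weight j * g1 j; pose h2 j := weight j * g2 j.
have g1P j : 0 <= g1 j <= 1.
  rewrite /g1; case: ifP => _; last by rewrite lexx ler01.
  apply/andP; split; first by rewrite subr_ge0 lerXn2r ?nnegrE ?ltW.
  apply: (@le_trans _ _ (y ^+ (j - o))); first by rewrite gerBl exprn_ge0// ltW.
  by rewrite exprn_ile1// ltW.
have g2P j : 0 <= g2 j <= 1.
  apply/andP; split; first by rewrite subr_ge0 exprn_ile1 ?ltW.
  by rewrite gerBl exprn_ge0// ltW.
have lg (g : nat -> R) : (forall j, 0 <= g j <= 1) -> forall j, 0 <= weight j * g j <= d.
  move=> gP j; have /andP[g0 gg1] := gP j.
  apply/andP; split; first by rewrite mulr_ge0// ltW.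
  by rewrite -[leRHS]mulr1 ler_pM ?weight_le// ltW.
have h1P := lg _ g1P; have h2P := lg _ g2P.
have u1 := scaled_unit h1P gam1_gt0 (ltW eta1_gt0) eta1P.
have u2 := scaled_unit h2P gam2_gt0 (ltW eta2_gt0) eta2P.
(* [h2] fails to be subharmonic at [k] only, where [eta1 * h1] dominates it. *)
pose f j := if (j <= k)%N then Num.max (eta1 * h1 j) (eta2 * h2 j) else 0.
have f01 : unit_vec f.
  move=> j; rewrite /f; case: ifP => _; last by rewrite lexx ler01.
  have /andP[a1 a2] := u1 j; have /andP[a3 a4] := u2 j.
  by rewrite le_max a1 /= ge_max a2 a4.
have g10 : g1 0%N = 0 by rewrite /g1 /= !expr0 subrr.
have g20 : g2 0%N = 0 by rewrite /g2 expr0 subrr.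
have fphi01 : unit_vec (f \o minn k) by move=> j; exact: f01.
have f1 j : eta1 * h1 (minn k j) <= f (minn k j).
  by rewrite /f geq_minl le_max lexx.
have f2 j : eta2 * h2 (minn k j) <= f (minn k j).
  by rewrite /f geq_minl le_max lexx orbT.
have sub1 j : (0 < j <= k)%N -> eta1 * h1 j <= F (f \o minn k) j.
  move=> jk; apply: le_trans (ler_surv_op a_gt0 c_gt0 d_gt1 fphi01 f1 j).
  apply: (scaled_sub h1P gam1_gt0 (ltW eta1_gt0) eta1P).
  rewrite [leRHS](mean_op_weight_minn (g := g1) lD)// /h1 mulrCA ler_pM2l//.
  have [jo|jo] := leqP j o.
    have -> : g1 j = 0.
      by rewrite /g1; case: ifP => // _; rewrite (eqP (_ : j - o == 0)%N) ?subn_eq0//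
        !expr0 subrr.
    have g1_ge0 n : 0 <= g1 n by case/andP: (g1P n).
    rewrite mulr0 addr_ge0 ?mulr_ge0 ?(ltW c_gt0) ?(ltW a_gt0)//.
    by case: ifP => // _; rewrite mulr_ge0// (le_trans _ (ltW xD))// ltW.
  case/andP: jk => j0 jk.
  have [n En] : exists n, j = (o + n).+1 by exists (j - o.+1)%N; clear -jo; lia.
  have Ej : (j - o = n.+1)%N by rewrite En; clear; lia.
  have Ej1 : (j.-1 - o = n)%N by rewrite En; clear; lia.
  have Ej2 : (j.+1 - o = n.+2)%N by rewrite En; clear; lia.
  have next : y ^+ n.+2 - x ^+ n.+2 <= (if (j < k)%N then g1 j.+1 else D * g1 k).
    case: ltnP => jk'; first by rewrite /g1 jk' Ej2.
    have Ek : (k - o = L)%N by rewrite subKn.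
    by rewrite /g1 leqnn Ek (_ : n.+2 = L.+1)//; clear -Ek Ej jk jk'; lia.
  apply: le_trans (lerD (ler_wpM2l (ltW c_gt0) next) (lexx _)).
  rewrite /g1 jk Ej Ej1 (_ : (j.-1 <= k)%N); last by rewrite (leq_trans (leq_pred j)).
  have E1 : (1 + gam1) * y = c * y ^+ 2 + a by rewrite /gam1; field; rewrite gt_eqF.
  have E2 : x = c * x ^+ 2 + a by move: x_root; lra.
  have -> : c * (y ^+ n.+2 - x ^+ n.+2) + a * (y ^+ n - x ^+ n) =
     (c * y ^+ 2 + a) * y ^+ n - (c * x ^+ 2 + a) * x ^+ n by rewrite !exprS; ring.
  rewrite -E1 -E2 mulrBr -!exprS exprS mulrA lerD2l lerN2 ler_peMl ?exprn_ge0 ?(ltW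
    x_gt0)//.
  by rewrite lerDl ltW.
have sub2 j : (0 < j < k)%N -> eta2 * h2 j <= F (f \o minn k) j.
  move=> /andP[j0 jk]; apply: le_trans (ler_surv_op a_gt0 c_gt0 d_gt1 fphi01 f2 j).
  apply: (scaled_sub h2P gam2_gt0 (ltW eta2_gt0) eta2P).
  rewrite [leRHS](mean_op_weight_minn (g := g2) lD) ?j0 ?(ltnW jk)// jk /h2 mulrCA
    ler_pM2l//.
  case: j j0 {jk} => // n _ /=; rewrite /g2.
  have E2 : x = c * x ^+ 2 + a by move: x_root; lra.
  have -> : c * (1 - x ^+ n.+2) + a * (1 - x ^+ n) = c + a - (c * x ^+ 2 + a) * x ^+ n.
    by rewrite !exprS; ring.
  rewrite -E2 -exprS /gam2 addrC addrNK mulrBr mulr1 lerD2l lerN2.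
  by rewrite ler_peMl ?exprn_ge0 ?(ltW x_gt0)//; move: gam2_gt0; rewrite subr_gt0 => /ltW.
have top2 : eta2 * h2 k <= eta1 * h1 k.
  rewrite /h1 /h2 mulrCA [leRHS]mulrCA ler_pM2l// /g1 leqnn.
  rewrite (_ : (k - o = L)%N); last by rewrite subKn.
  apply: (@le_trans _ _ eta2); last by rewrite ge_min lexx orbT.
  by rewrite ler_piMr ?(ltW eta2_gt0)//; case/andP: (g2P k).
have fF j : f j <= F (f \o minn k) j.
  case: (posnP j) => [->|j0]; first by rewrite surv_op_at0 /f /h1 /h2 g10 g20 !mulr0 maxxx.
  have F0 : 0 <= F (f \o minn k) j by case/andP: (surv_op_unit a_gt0 c_gt0 d_gt1 fphi01 j).
  rewrite {1}/f; case: leqP => // jk.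
  rewrite ge_max sub1 ?j0//=.
  case: (ltnP j k) => jk'; first by rewrite sub2 ?j0.
  have -> : j = k by apply/eqP; rewrite eqn_leq jk jk'.
  by apply: le_trans top2 _; apply: sub1; rewrite leqnn andbT (leq_trans j0).
have f0 : f 0%N = 0 by rewrite /f /h1 /h2 g10 g20 !mulr0 maxxx.
apply: le_trans (survival_le_sub a_gt0 c_gt0 d_gt1 i f01 f0 fF).
case/andP: ik => i0 ik; rewrite /f ik le_max; apply/orP; right.
rewrite ler_pM2l//; apply: (@le_trans _ _ (g2 i)).
  rewrite lerD2l lerN2; case: i i0 {ik} => // n _.
  by rewrite exprS ler_piMr ?exprn_ile1 ?ltW.
by rewrite ler_peMl ?weight_ge1//; case/andP: (g2P i).
Qed.

End Root.
End Subharmonic.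

(** * Avoidance events of the genealogical tree *)

Lemma countable_enum (V : choiceType) (v0 : V) : countable [set: V] ->
  infinite_set [set: V] -> exists e : nat -> V, set_bij [set: nat] [set: V] e.
Proof.
move=> cV iV; pose U : pointedType := HB.pack V (isPointed.Build V v0).
have : ([set: nat] #= [set: U])%card by rewrite card_eq_sym; exact: eq_card_nat.
by move/card_set_bijP.
Qed.

(** Turns sums and unions over configurations into series and unions over [nat]. *)
Lemma config_enum : exists e : nat -> config, set_bij [set: nat] [set: config] e.
Proof.
apply: countable_enum; first exact: (seq_mset [::]).
  apply/countable_injP.
  exists (fun A : config => choice.pickle (A : seq nat)) => A B _ _.
  move/(pcan_inj choice.pickleK) => AB.
  by rewrite -(seq_mset_id A) AB seq_mset_id.
move=> /(finite_image (fun A : config => A 0%N)).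
rewrite (_ : [set _ | _ in _] = [set: nat]); first exact: infinite_nat.
apply/seteqP; split=> // n _; exists (seq_mset (nseq n 0%N)) => //.
by rewrite mset_seqE count_nseq mul1n.
Qed.

Section Tree.
Variables (off : label -> nat -> config) (retype : label -> nat -> nat).

Definition offspring (x : label * nat) : seq (label * nat) :=
  [seq (rcons x.1 b, retype (rcons x.1 b) b.1) | b <- children (off x.1 x.2)].

Fixpoint all_desc (Q : pred nat) (n : nat) (x : label * nat) : bool :=
  if n is m.+1 then all (all_desc Q m) (offspring x) else Q x.2.

(** [generation] grows the tree at its last generation, whereas [all_desc] branches at the first, as
    conditioning on the offspring of the ancestor requires. The induction moves generations one by
    one from the first description to the second. *)
Lemma all_generation Q i n :
  all (fun x => Q x.2) (generation off retype i n) = all_desc Q n ([::], retype [::] i).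
Proof.
rewrite -[n in RHS]addn0 -[LHS]/(all (all_desc Q 0) _).
elim: n 0%N => [|n IH] m; first by rewrite /= andbT.
rewrite addSnnS -IH /=; elim: (generation _ _ _ _) => //= x s IHs.
by rewrite all_cat IHs.
Qed.
End Tree.

(** * Measurability of avoidance events *)

Section DiscreteMeasurability.
Context {disp : measure_display} {T : measurableType disp}.

Lemma discrete_bind (V : Type) (e : nat -> V) (X : T -> V) (E : V -> set T) :
  set_surj [set: nat] [set: V] e -> discrete_random X ->
  (forall r, measurable (E r)) -> measurable [set w | E (X w) w].
Proof.
move=> surj mX mE.
rewrite (_ : [set w | _] = \bigcup_n (X @^-1` [set e n] `&` E (e n))).
  by apply: bigcup_measurable => n _; exact: measurableI.
apply/seteqP; split=> w /=; last by case=> n _ [/= <-].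
by move=> Ew; have [n _ en] := surj (X w) Logic.I; exists n => //=; rewrite en.
Qed.

Lemma measurable_all (I : Type) (s : seq I) (b : I -> T -> bool) :
  (forall x, measurable [set w | b x w]) -> measurable [set w | all (fun x => b x w) s].
Proof.
move=> mb; elim: s => [|x s IH] /=.
  by rewrite (_ : [set _ | _] = setT)//; apply/seteqP; split.
rewrite (_ : [set _ | _] = [set w | b x w] `&` [set w | all (fun x => b x w) s]).
  exact: measurableI.
by apply/seteqP; split=> w /= => [/andP[]|[-> ->]].
Qed.

Section Descendants.
Variables (xi : label -> nat -> T -> config) (ret : label -> nat -> T -> nat).
Hypothesis xi_meas : forall v j, discrete_random (xi v j).
Hypothesis ret_meas : forall v j, discrete_random (ret v j).

Definition desc Q n x : set T :=
  [set w | all_desc (fun v j => xi v j w) (fun v j => ret v j w) Q n x].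

Lemma measurable_desc Q n v j : measurable (desc Q n (v, j)).
Proof.
elim: n v j => [|n IH] v j.
  by rewrite /desc /=; case: (Q j);
    [rewrite (_ : [set _ | _] = setT)|rewrite (_ : [set _ | _] = set0)];
    rewrite //; apply/seteqP; split.
have [e [_ _ se]] := config_enum.
pose E (r : config) := [set w | all (fun b => all_desc (fun v j => xi v j w)
  (fun v j => ret v j w) Q n (rcons v b, ret (rcons v b) b.1 w)) (children r)].
rewrite (_ : desc _ _ _ = [set w | E (xi v j w) w]); last first.
  by apply/seteqP; split=> w; rewrite /desc /E /= /offspring all_map.
apply: (discrete_bind se) => // r; apply: measurable_all => b.
by apply: (@discrete_bind _ id (ret (rcons v b) b.1) (fun m => desc Q n (rcons v b, m))).
Qed.
End Descendants.
End DiscreteMeasurability.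

(** * Branching property *)

Section Branching.
Context {disp : measure_display} {T : measurableType disp} {R : realType}.
Variable (P : probability T R).
Variables (p : nat -> config -> R) (xi : label -> nat -> T -> config).
Hypothesis xiP : offspring_variables P p xi.
Variable (phi : nat -> nat).
Hypothesis phi_gt0 : forall j, (0 < j)%N -> (0 < phi j)%N.
Variables (a c d : R).
Hypotheses (a_gt0 : 0 < a) (c_gt0 : 0 < c) (d_gt1 : 1 < d).
Hypothesis pG : forall i (s : nat -> R), (0 < i)%N -> (forall j, 0 <= s j <= 1) ->
       progeny_gf (p i) s = (G a c d i s)%:E.

Lemma law_ge0 i r : (0 < i)%N -> 0 <= p i r.
Proof. by move=> i0; have [/(_ r)] := offspring_law xiP i0. Qed.

(** [G] does not involve [s 0]. Evaluating at the indicator of positive types therefore still gives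
    1, leaving no mass for configurations containing type 0. *)
Lemma no_type0_children i (r : config) : (0 < i)%N -> (0 < r 0%N)%N -> p i r = 0.
Proof.
move=> i0 r0; pose s (j : nat) : R := (0 < j)%N%:R.
have s01 j : 0 <= s j <= 1 by rewrite ler0n lern1 leq_b1.
have s1 : progeny_gf (p i) s = 1%E.
  rewrite pG// /G /s; case: i i0 => [//|[|i]] _ /=.
    by congr (_%:E); rewrite expr1n; ring.
  by case: ifP => _; congr (_%:E); rewrite !expr1n; ring.
have pr0 : (0 < r 0%N)%N -> \prod_(j <- finsupp r) s j ^+ r j = 0.
  move=> r00; have r0in : 0%N \in finsupp r by rewrite msuppE in_mset.
  by rewrite (big_fsetD1 0%N r0in) /= /s /= expr0n eqn0Ngt r00 mul0r.
have prod01 (q : config) : 0 <= \prod_(j <- finsupp q) s j ^+ q j <= 1.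
  elim/big_ind: _ => [|x y /andP[x0 x1] /andP[y0 y1]|j _]; first by rewrite ler01 lexx.
    by rewrite mulr_ge0//= mulr_ile1.
  by have /andP[s0 s1'] := s01 j; rewrite exprn_ge0//= exprn_ile1.
have [_ p1] := offspring_law xiP i0.
pose pr (q : config) : R := \prod_(j <- finsupp q) s j ^+ q j.
have : (\esum_(q in [set: config]) (p i q)%:E =
  \esum_(q in [set: config]) (p i q * pr q)%:E
  + \esum_(q in [set: config]) (p i q * (1 - pr q))%:E)%E.
  rewrite -esumD.
  - by apply: eq_esum => q _; rewrite -EFinD -mulrDr addrC subrK mulr1.
  - by move=> q _; rewrite lee_fin mulr_ge0 ?law_ge0//; case/andP: (prod01 q).
  - by move=> q _; rewrite lee_fin mulr_ge0 ?law_ge0// subr_ge0; case/andP: (prod01 q).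
rewrite p1 [X in (X + _)%E](s1 : _ = 1%E) => /esym/eqP.
rewrite -[X in _ == X]adde0.
move=> sum0.
have {}sum0 : (\esum_(q in [set: config]) (p i q * (1 - pr q))%:E = 0)%E.
  move: sum0; case: (\esum_(q in _) _)%E => [x| |] //=.
  by rewrite adde0 => /eqP[] /(canRL (addKr _)) ->; rewrite addNr.
suff : ((p i r)%:E <= 0%E)%E.
  by rewrite lee_fin => le0; apply/eqP; rewrite eq_le law_ge0// le0.
rewrite -sum0; apply: esum_ge; exists [set r]; first by split=> //; exact: finite_set1.
by rewrite fsbig_set1 lee_fin /pr pr0// subr0 mulr1.
Qed.

Lemma discrete_partition (E : set T) v j : measurable E ->
  P E = \esum_(r in [set: config]) P (E `&` xi v j @^-1` [set r]).
Proof.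
move=> mE; have [e be] := config_enum; have [_ ie se] := be.
have mX r : measurable (xi v j @^-1` [set r]) by exact: (offspring_measurable xiP).
rewrite (@reindex_esum _ _ _ _ _ e _ be).
rewrite [X in esum X _](_ : _ = [set n | n \in [set: nat]]); last first.
  by apply/seteqP; split=> n //= _; rewrite inE.
rewrite -nneseries_esum// -measure_bigcup//.
- rewrite -setI_bigcupr -preimage_bigcup (_ : \bigcup_n _ = setT) ?preimage_setT ?setIT//.
  by apply/seteqP; split=> // r _; have [n _ <-] := se r Logic.I; exists n.
- by move=> n _; exact: measurableI.
- apply/trivIsetP => m n _ _ mn; apply/seteqP; split=> // w [[_ /= Em] [_ /= En]].
  by move/eqP: mn; apply; apply: ie; rewrite ?inE// -Em -En.
Qed.
Lemma esum_configZ (x : R) (b : config -> \bar R) : 0 <= x -> (forall r, 0 <= b r)%E ->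
  (\esum_(r in [set: config]) (x%:E * b r) = x%:E * \esum_(r in [set: config]) b r)%E.
Proof.
move=> x0 b0; have [e be] := config_enum.
rewrite !(@reindex_esum _ _ _ _ _ e _ be) -!nneseries_esumT ?nneseriesZl// => n.
by rewrite mule_ge0.
Qed.

Definition cylinder (J : {fset label * nat}) (A : label * nat -> set config) : set T :=
  \bigcap_(y in [set` J]) (xi y.1 y.2 @^-1` A y).

Lemma measurable_cylinder J A : measurable (cylinder J A).
Proof.
apply: fin_bigcap_measurable => [|y _]; first exact: finite_fset.
exact: (offspring_measurable xiP).
Qed.

Definition fix_value (A : label * nat -> set config) (y : label * nat) (r : config) :=
  fun z => if z == y then [set r] else A z.

Lemma cylinder_fix J A y r : y \notin J ->
  cylinder (y |` J)%fset (fix_value A y r) = cylinder J A `&` xi y.1 y.2 @^-1` [set r].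
Proof.
move=> yJ; rewrite /fix_value; apply/seteqP; split=> w /=.
  move=> h; split=> [z /= zJ|].
    have := h z; rewrite /= !inE zJ orbT ifN; first exact.
    by apply: contraNneq yJ => <-.
  by have := h y; rewrite /= !inE eqxx => /(_ isT).
move=> [h wr] z /=; rewrite !inE; case: eqP => [->//|_] /= zJ.
exact: h.
Qed.

Lemma prob_cylinder_fix J A y r : y \notin J -> (0 < y.2)%N ->
  (P (cylinder (y |` J)%fset (fix_value A y r)) = P (cylinder J A) * (p y.2 r)%:E)%E.
Proof.
move=> yJ y0; rewrite /cylinder !(offspring_indep xiP) big_fsetU1//= muleC.
congr (_ * _)%E; last by rewrite /fix_value eqxx (offspring_distr xiP).
apply: eq_big_seq => z zJ; rewrite /fix_value ifN//.
by apply: contraNneq yJ => <-.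
Qed.

Variable Q : pred nat.

(** All descendants, [n] generations later, of the individuals listed in [F] have types in [Q]. *)
Definition misses n (F : seq (label * nat)) : set T :=
  [set w | all (all_desc (fun v j => xi v j w) (fun _ => phi) Q n) F].

Definition miss_prob n j : R :=
  1 - surv a c d phi (fun j => ((0 < j)%N && ~~ Q j)%:R) n j.

Lemma miss_unit n j : 0 <= miss_prob n j <= 1.
Proof.
have /andP[s0 s1] : 0 <= surv a c d phi (fun j => ((0 < j)%N && ~~ Q j)%:R) n j <= 1.
  by apply: surv_unit => // i; rewrite ler0n lern1 leq_b1.
by rewrite subr_ge0 s1 gerBl s0.
Qed.

Lemma miss_probS n i : (0 < i)%N ->
  miss_prob n.+1 i = G a c d i (fun j => miss_prob n (phi j)).
Proof.
move=> i0; rewrite -[RHS](subKr 1) -surv_op_G// /miss_prob /=; congr (_ - surv_op _ _ _ _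
  _).
by apply/funext => j /=; rewrite subKr.
Qed.

Lemma measurable_misses n F : measurable (misses n F).
Proof.
apply: measurable_all => -[v j].
apply: (@measurable_desc _ _ xi (fun _ j _ => phi j)); first exact: offspring_measurable
  xiP.
move=> v' j' A; have [Aj|nAj] := pselect (A (phi j')).
  by rewrite (_ : _ @^-1` _ = setT)//; apply/seteqP; split.
by rewrite (_ : _ @^-1` _ = set0)//; apply/seteqP; split.
Qed.

Lemma misses_cat n F F' : misses n (F ++ F') = misses n F `&` misses n F'.
Proof. by apply/seteqP; split=> w; rewrite /misses /= all_cat => /andP. Qed.

Lemma uniq_children (r : config) : uniq (children r).
Proof.
apply: allpairs_uniq_dep => [|j _|]; first exact: fset_uniq.
  exact: iota_uniq.
by move=> [j l] [j' l'] _ _ /= [-> ->].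
Qed.

Lemma prod_children (f : nat -> R) (r : config) :
  \prod_(b <- children r) f b.1 = \prod_(j <- finsupp r) f j ^+ r j.
Proof.
rewrite /children big_allpairs_dep /=; apply: eq_bigr => j _.
by rewrite /= big_const_seq count_predT size_iota iter_mulr_1.
Qed.

(** The branching property, stated jointly with a cylinder on earlier generations so that revealed
    offspring can be accumulated in [J]. Labels, not just pairs, are distinct in [F]: the subtrees
    then use disjoint driving variables. *)
Definition independent_of_misses n := forall l F J A,
  {in F, forall x, size x.1 = l /\ (0 < x.2)%N} -> uniq (map fst F) ->
  {in J, forall y, (size y.1 < l)%N} ->
  (P (cylinder J A `&` misses n F) = P (cylinder J A) * (\prod_(x <- F) miss_prob n
    x.2)%:E)%E.

(* The offspring of the individuals in F1 are revealed one individual at a time,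
   each one moving its children to F2. *)
Lemma misses_step n : independent_of_misses n -> forall l F1 F2 J A,
  {in F1, forall x, size x.1 = l /\ (0 < x.2)%N} -> uniq (map fst F1) ->
  {in F2, forall x, size x.1 = l.+1 /\ (0 < x.2)%N} -> uniq (map fst F2) ->
  {in F1 & F2, forall x y b, y.1 <> rcons x.1 b} ->
  {in J, forall y, (size y.1 <= l)%N} -> {in F1, forall x, x \notin J} ->
  (P (cylinder J A `&` misses n.+1 F1 `&` misses n F2) =
   P (cylinder J A) * (\prod_(x <- F1) miss_prob n.+1 x.2)%:E
     * (\prod_(x <- F2) miss_prob n x.2)%:E)%E.
Proof.
move=> indn l; elim=> [|[v i] F1 IH] F2 J A F1P u1 F2P u2 F12 JP FJ.
  rewrite big_nil mule1 (_ : misses n.+1 [::] = setT); last by apply/seteqP; split.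
  by rewrite setIT; apply: (indn l.+1).
have /= [vl i0] := F1P _ (mem_head _ _).
have viJ : (v, i) \notin J by apply: FJ; rewrite mem_head.
move: u1 => /= /andP[vF1 u1].
pose kids (r : config) := [seq (rcons v b, phi b.1) | b <- children r].
set E := _ `&` misses n F2.
have mE : measurable E.
  by apply: measurableI; [apply: measurableI|];
    [exact: measurable_cylinder|exact: measurable_misses|exact: measurable_misses].
(* Revealing the offspring [r] of [(v, i)] records it in the cylinder and moves the children to the
   list awaiting [n] generations. *)
have EE (r : config) : E `&` xi v i @^-1` [set r] =
    cylinder ((v, i) |` J)%fset (fix_value A (v, i) r) `&` misses n.+1 F1
    `&` misses n (F2 ++ kids r).
  rewrite cylinder_fix//= misses_cat; apply/seteqP; split=> w.
    move=> [[[wJ]]]; rewrite /misses /= => /andP[wk wF1] wF2 wr; split; last split=> //.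
      by split.
    by move: wk; rewrite /offspring /= wr.
  move=> [[[wJ wr] wF1] [wF2 wk]]; split=> //; split=> //; split=> //.
  by rewrite /misses /=; apply/andP; split=> //; rewrite /offspring /= wr.
have Er (r : config) : P (E `&` xi v i @^-1` [set r]) =
  (P (cylinder J A) * (\prod_(x <- F1) miss_prob n.+1 x.2)%:E
    * (\prod_(x <- F2) miss_prob n x.2)%:E
    * (p i r * \prod_(j <- finsupp r) miss_prob n (phi j) ^+ r j)%:E)%E.
  (* The induction needs children of positive type; otherwise both sides are 0. *)
  have [r0|r0] := posnP (r 0%N); last first.
    have pr : P (xi v i @^-1` [set r]) = 0%E.
      by rewrite (offspring_distr xiP)// no_type0_children.
    rewrite no_type0_children// mul0r mule0.
    apply/eqP; rewrite eq_le measure_ge0 andbT -pr le_measure ?inE//.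
      by apply: measurableI => //; exact: (offspring_measurable xiP).
    exact: (offspring_measurable xiP).
  rewrite EE IH.
  - rewrite prob_cylinder_fix//= big_cat /= EFinM big_map /= (prod_children (miss_prob n
    \o phi)).
    rewrite EFinM /= -!muleA; congr (_ * _)%E; rewrite -!EFinM; congr (_%:E).
    by ring.
  - by move=> x xF; apply: F1P; rewrite inE xF orbT.
  - by [].
  - move=> x; rewrite mem_cat => /orP[/F2P//|/mapP[b bk ->]] /=.
    rewrite size_rcons vl; split=> //; apply: phi_gt0.
    move: bk => /allpairsPdep[j [m [jr _ ->]]] /=.
    rewrite lt0n; apply: contraTneq jr => ->.
    by rewrite msuppE in_mset r0.
  - rewrite map_cat cat_uniq u2 /= -map_comp map_inj_uniq ?uniq_children; last first.
      by move=> b b' /= /rcons_inj[].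
    rewrite andbT; apply/hasPn => _ /mapP[b _ ->] /=.
    apply/negP => /mapP[y yF2 /esym]; exact: (F12 (v, i) y (mem_head _ _) yF2).
  - move=> x y xF; rewrite mem_cat => /orP[yF|/mapP[b bk ->]] b'.
      by apply: F12 => //; rewrite inE xF orbT.
    move=> /= /rcons_inj[vx _]; move/negP: vF1; apply.
    by rewrite vx; apply: map_f.
  - move=> y; rewrite !inE => /orP[/eqP ->/=|/JP//]; by rewrite vl.
  - move=> x xF; rewrite !inE negb_or FJ ?inE ?xF ?orbT// andbT.
    by apply: contraNneq vF1 => /= xv; apply/mapP; exists x => //; rewrite xv.
rewrite (discrete_partition v i mE) (eq_esum (fun r _ => Er r)).
have [s Es] : exists2 s : R, 0 <= s & (P (cylinder J A) * (\prod_(x <- F1) miss_prob n.+1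
  x.2)%:E
    * (\prod_(x <- F2) miss_prob n x.2)%:E)%E = s%:E.
  have prod_ge0 m (F : seq (label * nat)) : 0 <= \prod_(x <- F) miss_prob m x.2.
    by apply: prodr_ge0 => x _; case/andP: (miss_unit m x.2).
  exists (fine (P (cylinder J A)) * (\prod_(x <- F1) miss_prob n.+1 x.2) * (\prod_(x <-
    F2) miss_prob n x.2)).
    by rewrite !mulr_ge0// fine_ge0.
  by rewrite !EFinM fineK// fin_num_measure//; exact: measurable_cylinder.
move=> sE; under eq_esum do rewrite sE.
rewrite esum_configZ//; last first.
  move=> r; rewrite lee_fin mulr_ge0 ?law_ge0// prodr_ge0// => j _.
  by rewrite exprn_ge0//; case/andP: (miss_unit n (phi j)).
(* The sum over the revealed offspring is by definition the progeny generating function. *)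
rewrite [X in (_ * X)%E](_ : _ = progeny_gf (p i) (fun j => miss_prob n (phi j)))//.
rewrite pG//; last by move=> j; exact: miss_unit.
rewrite big_cons /= miss_probS// EFinM.
rewrite -sE -!muleA; congr (_ * _)%E; rewrite -!EFinM; congr (_%:E); ring.
Qed.

Lemma independent_of_missesP n : independent_of_misses n.
Proof.
elim: n => [|n IH] l F J A FP uF JP.
  elim: F FP uF => [|x F IHF] FP uF.
    rewrite big_nil mule1 (_ : misses 0 [::] = setT) ?setIT//.
    by apply/seteqP; split.
  have [_ x0] := FP _ (mem_head _ _).
  rewrite big_cons {1}/miss_prob /= x0 /=.
  case Qx: (Q x.2) => /=; last first.
    rewrite subrr mul0r mule0 (_ : misses 0 _ = set0) ?setI0 ?measure0//.
    by apply/seteqP; split=> w //=; rewrite /misses /= Qx.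
  rewrite subr0 mul1r -IHF; last by case/andP: uF.
    congr (P (_ `&` _)); apply/seteqP; split=> w; rewrite /misses /= Qx //.
  by move=> y yF; apply: FP; rewrite inE yF orbT.
have := @misses_step n IH l F [::] J A FP uF.
rewrite big_nil mule1 (_ : misses n [::] = setT) ?setIT; last first.
  by apply/seteqP; split.
apply=> // [y /JP/ltnW//|x xF].
by apply/negP => /JP; have [-> _] := FP _ xF; rewrite ltnn.
Qed.

Lemma prob_desc n j : (0 < j)%N ->
  P (desc xi (fun _ j _ => phi j) Q n ([::], j)) = (miss_prob n j)%:E.
Proof.
move=> j0; have := @independent_of_missesP n 0 [:: ([::], j)] fset0 (fun _ => setT).
rewrite (_ : cylinder _ _ = setT); last by apply/seteqP; split.
rewrite setTI probability_setT mul1e big_seq1 /= => <- //.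
- by congr (P _); apply/seteqP; split=> w; rewrite /misses /desc /= andbT.
- by move=> x; rewrite inE => /eqP ->.
Qed.
End Branching.

(** * Extinction probabilities *)

Section Populations.
Variables (off : label -> nat -> config) (retype : label -> nat -> nat).

Lemma total_seq_mset_eq0 (s : seq nat) : Defs.total (seq_mset s) = 0%N <-> s = [::].
Proof.
rewrite /Defs.total; split=> [/eqP|->].
  rewrite sum_nat_seq_eq0 => /allP s0; case: s s0 => // x s s0.
  have := s0 x; rewrite /= msuppE in_mset mset_seqE /= eqxx => /(_ isT).
  by [].
by apply: big1 => j _; rewrite mset_seqE.
Qed.

Lemma total_population_eq0 i n :
  Defs.total (population off retype i n) = 0%N <->
  all_desc off retype pred0 n ([::], retype [::] i).
Proof.
rewrite /population total_seq_mset_eq0 -all_generation.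
by case: (generation _ _ _ _) => [|x s].
Qed.

Lemma total_population_eq0S i n :
  Defs.total (population off retype i n) = 0%N -> Defs.total (population off retype i
    n.+1) = 0%N.
Proof.
rewrite /population !total_seq_mset_eq0 /=.
by case: (generation _ _ _ _).
Qed.

Lemma population_type_eq0 i n l :
  population off retype i n l = 0%N <->
  all_desc off retype (predC1 l) n ([::], retype [::] i).
Proof.
rewrite /population mset_seqE -all_generation; split=> [/eqP|].
  rewrite -leqn0 leqNgt -has_count -all_predC all_map.
  by apply: sub_all => x.
move=> h; apply/eqP; rewrite -leqn0 leqNgt -has_count -all_predC all_map.
by apply: sub_all h => x.
Qed.
End Populations.

Lemma nat_cvg0 (R : realType) (u : nat -> nat) :
  (fun n => (u n)%:R : R) @ \oo --> (0 : R) <-> exists N, forall n, (N <= n)%N -> u n = 0%N.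
Proof.
split=> [/cvgrPdist_lt/(_ 1 ltr01)[N _ h]|[N h]].
  exists N => n Nn; have := h n Nn.
  by rewrite /= sub0r normrN normr_nat (ltr_nat R (u n) 1) ltnS leqn0 => /eqP.
apply/cvgrPdist_lt => e e0; exists N => // n /= /h ->.
by rewrite subrr normr0.
Qed.

Section Extinction.
Context {disp : measure_display} {T : measurableType disp} {R : realType}.
Variable (P : probability T R).

Lemma prob_nested_limit (D : nat -> set T) (u : nat -> R) (l : R) :
  (forall n, measurable (D n)) -> (forall n, D n `<=` D n.+1) ->
  (forall n, P (D n) = (u n)%:E) -> u @ \oo --> l -> P (\bigcup_n D n) = l%:E.
Proof.
move=> mD sD PD ul.
have h : (P \o D) @ \oo --> P (\bigcup_n D n).
  apply: nondecreasing_cvg_mu => //; first exact: bigcupT_measurable.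
  by apply/nondecreasing_seqP => n; apply/subsetPset; exact: sD.
have h' : (P \o D) @ \oo --> l%:E.
  apply: cvg_EFin; first by apply: nearW => n /=; rewrite PD.
  by rewrite (_ : fine \o _ = u)//; apply/funext => n /=; rewrite PD.
exact: (cvg_unique _ h h').
Qed.

Lemma prob_extinction (D : nat -> set T) (u : nat -> R) (l : R) (Y : nat -> T -> config) :
  (forall n, measurable (D n)) -> (forall n w, D n w <-> Defs.total (Y n w) = 0%N) ->
  (forall n w, Defs.total (Y n w) = 0%N -> Defs.total (Y n.+1 w) = 0%N) ->
  (forall n, P (D n) = (u n)%:E) -> u @ \oo --> l ->
  P [set w | (fun n => (Defs.total (Y n w))%:R : R) @ \oo --> (0 : R)] = l%:E.
Proof.
move=> mD DY YS PD ul; rewrite -(prob_nested_limit mD _ PD ul); last first.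
  by move=> n w /DY/YS/DY.
congr (P _); apply/seteqP; split=> w /=; rewrite nat_cvg0.
  by move=> [N /(_ N (leqnn N))/DY]; exists N.
move=> [N _ /DY YN]; exists N => n; elim: n => [|n IH].
  by rewrite leqn0 => /eqP N0; move: YN; rewrite N0.
by rewrite leq_eqVlt => /orP[/eqP <-//|]; rewrite ltnS => /IH/YS.
Qed.

Section WithLaw.
Variables (p : nat -> config -> R) (xi : label -> nat -> T -> config).
Hypothesis xiP : offspring_variables P p xi.
Variables (a c d : R).
Hypotheses (a_gt0 : 0 < a) (c_gt0 : 0 < c) (d_gt1 : 1 < d).
Hypothesis pG : forall i (s : nat -> R), (0 < i)%N -> (forall j, 0 <= s j <= 1) ->
       progeny_gf (p i) s = (G a c d i s)%:E.

Let measurable_desc_det (phi : nat -> nat) Q n x :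
  measurable (desc xi (fun _ j _ => phi j) Q n x).
Proof.
case: x => v j; apply: measurable_desc; first exact: offspring_measurable xiP.
move=> v' j' A; have [Aj|nAj] := pselect (A (phi j')).
  by rewrite (_ : _ @^-1` _ = setT)//; apply/seteqP; split.
by rewrite (_ : _ @^-1` _ = set0)//; apply/seteqP; split.
Qed.

Lemma miss_prob_extinct (phi : nat -> nat) n j :
  miss_prob phi a c d pred0 n j = 1 - alive a c d phi n j.
Proof.
by rewrite /miss_prob /alive; congr (1 - surv _ _ _ _ _ _ _); apply/funext => i; rewrite
  andbT.
Qed.

Lemma global_extinction_Z i : (0 < i)%N ->
  global_extinction P (Z xi) i = 1 - survival a c d id i.
Proof.
move=> i0; rewrite /global_extinction.
rewrite (@prob_extinction (fun n => desc xi (fun _ j _ => j) pred0 n ([::], i))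
  (fun n => 1 - alive a c d id n i) (1 - survival a c d id i))//.
- by move=> n w; rewrite /Z total_population_eq0.
- by move=> n w; exact: total_population_eq0S.
- by move=> n; rewrite -miss_prob_extinct (prob_desc xiP (phi := id) (fun _ h => h) a_gt0
  c_gt0 d_gt1 pG).
- by apply: cvgB; [exact: cvg_cst|exact: cvg_alive].
Qed.

(** Replacement types equal [k] almost surely and labels are countable, so off one null set the
    random retyping is the deterministic [minn k], applied to the initial type as well. *)
Lemma global_extinction_Zbar k rho i : (0 < k)%N -> (0 < i)%N ->
  replacement_variables P xi k (point_mass k) rho ->
  global_extinction P (Zbar xi k rho) i = 1 - survival a c d (minn k) (minn k i).
Proof.
move=> k0 i0 rhoP; rewrite /global_extinction.
pose ret (v : label) j w := if (j <= k)%N then j else rho v w.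
have mret v j : discrete_random (ret v j).
  move=> A; rewrite /ret; case: leqP => _; last exact: (replacement_measurable rhoP).
  have [Aj|nAj] := pselect (A j).
    by rewrite (_ : _ @^-1` _ = setT)//; apply/seteqP; split.
  by rewrite (_ : _ @^-1` _ = set0)//; apply/seteqP; split.
pose D n := [set w | desc xi ret pred0 n ([::], ret [::] i w) w].
(* Exceptional events indexed by coded labels; integers coding no label get the empty event. *)
pose F n := if choice.unpickle n is Some v then rho v @^-1` (~` [set k]) else set0.
have mF n : measurable (F n).
  by rewrite /F; case: choice.unpickle => [v|]//; exact: (replacement_measurable rhoP).
have F0 n : P (F n) = 0%E.
  rewrite /F; case: choice.unpickle => [v|]; last by rewrite measure0.
  rewrite -preimage_setC probability_setC; last exact: (replacement_measurable rhoP).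
  by rewrite (replacement_distr rhoP) /point_mass eqxx subee.
have null : P (\bigcup_n F n) = 0%E.
  apply/negligibleP; first exact: bigcupT_measurable.
  by apply: negligible_bigcup => n; apply/negligibleP; [exact: mF|exact: F0].
have retE w v j : (~` \bigcup_n F n) w -> ret v j w = minn k j.
  move=> nF; have rk : rho v w = k.
    apply: contrapT => rk; apply: nF; exists (choice.pickle v) => //.
    by rewrite /F choice.pickleK.
  by rewrite /ret rk; case: leqP.
have mD n : measurable (D n).
  apply: (@discrete_bind _ _ nat id (ret [::] i) (fun m => desc xi ret pred0 n ([::],
    m))) => //.
  by move=> m; apply: measurable_desc => //; exact: offspring_measurable xiP.
have PD n : P (D n) = (1 - alive a c d (minn k) n (minn k i))%:E.
  have mk j : (0 < j)%N -> (0 < minn k j)%N by move=> j0; rewrite leq_min k0.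
  rewrite -miss_prob_extinct -(prob_desc xiP mk a_gt0 c_gt0 d_gt1 pG); last exact: mk.
  set D' := desc _ _ _ _ _.
  have mD' : measurable D' by exact: measurable_desc_det.
  have sub A B : measurable A -> measurable B ->
      A `&` ~` (\bigcup_n F n) `<=` B -> (P A <= P B)%E.
    move=> mA mB AB; have mU := bigcupT_measurable _ mF.
    have : (P A <= P (B `|` (\bigcup_n F n)))%E.
      apply: le_measure; rewrite ?inE//; first exact: measurableU.
      move=> w Aw; have [Fw|nFw] := pselect ((\bigcup_n F n) w); first by right.
      by left; apply: AB.
    move=> /le_trans; apply; apply: (le_trans (measureU2 P mB mU)).
    by rewrite [X in (_ + X)%E](null : _ = 0%E) adde0.
  have E w : (~` \bigcup_n F n) w -> D n w <-> D' w.
    move=> nF; rewrite /D /D' /desc /= retE//.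
    by rewrite (_ : (fun v j => ret v j w) = (fun _ => minn k))//; apply/funext => v;
      apply/funext => j; exact: retE.
  by apply/eqP; rewrite eq_le !sub// => w [h nF]; apply/(E w nF).
rewrite (@prob_extinction D (fun n => 1 - alive a c d (minn k) n (minn k i))
  (1 - survival a c d (minn k) (minn k i)))//.
- by move=> n w; rewrite /Zbar total_population_eq0.
- by move=> n w; exact: total_population_eq0S.
- by apply: cvgB; [exact: cvg_cst|exact: cvg_alive].
Qed.

Let visits l n i := desc xi (fun _ j _ => j) (predC1 l) n ([::], i).

Let local_extinct l i := [set w | (fun n => (Z xi i n w l)%:R : R) @ \oo --> (0 : R)].

Let local_extinctE l i :
  local_extinct l i = \bigcup_N \bigcap_n (visits l (N + n) i).
Proof.
apply/seteqP; split=> w; rewrite /local_extinct /= nat_cvg0.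
  move=> [N h]; exists N => // n _; apply/population_type_eq0.
  by apply: h; rewrite leq_addr.
move=> [N _ h]; exists N => n Nn; apply/population_type_eq0.
by have := h (n - N)%N Logic.I; rewrite subnKC.
Qed.

Let measurable_local_extinct l i : measurable (local_extinct l i).
Proof.
rewrite local_extinctE; apply: bigcupT_measurable => N.
by apply: bigcapT_measurable => n; exact: (measurable_desc_det id).
Qed.

Let partialE i : [set w | forall l, (0 < l)%N ->
    (fun n => (Z xi i n w l)%:R : R) @ \oo --> (0 : R)] =
  \bigcap_l local_extinct l.+1 i.
Proof.
apply/seteqP; split=> w /= h; first by move=> l _; exact: h.
by move=> [//|l] _; exact: h.
Qed.

Let measurable_partial i : measurable (\bigcap_l local_extinct l.+1 i).
Proof. by apply: bigcapT_measurable => l. Qed.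

(** Borel-Cantelli for each type [l]: failure of local extinction is the limit superior of the
    events that generation [n] contains type [l], whose probabilities have bounded partial sums. *)
Lemma partial_extinction_eq1 i : (0 < i)%N ->
  (forall l, (0 < l)%N -> exists A : R, forall N,
     \sum_(n < N) surv a c d id (fun j => (j == l)%:R) n i <= A) ->
  partial_extinction P (Z xi) i = 1.
Proof.
move=> i0 bounded; rewrite /partial_extinction partialE.
suff : P (~` \bigcap_l local_extinct l.+1 i) = 0%E.
  rewrite probability_setC//.
  have : P (\bigcap_l local_extinct l.+1 i) \is a fin_num by exact: fin_num_measure.
  case: (P _) => [r| |]//= _ /eqP; rewrite -EFinD eqe subr_eq0 => /eqP <-.
  by [].
rewrite setC_bigcap; apply/negligibleP.
  by apply: bigcupT_measurable => l; apply: measurableC; exact: measurable_local_extinct.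
apply: negligible_bigcup => l; apply/negligibleP; first by apply: measurableC; exact:
  measurable_local_extinct.
have mv n : measurable (~` visits l.+1 n i).
  by apply: measurableC; exact: (measurable_desc_det id).
have -> : ~` local_extinct l.+1 i = lim_sup_set (fun n => ~` visits l.+1 n i).
  rewrite local_extinctE setC_bigcup; apply: eq_bigcap => // N _.
  rewrite setC_bigcap; apply/seteqP; split=> w [n] h.
    by exists (N + n)%N => //=; rewrite leq_addr.
  by exists (n - N)%N => //; rewrite subnKC.
apply: lim_sup_set_cvg0 => //.
have [A AP] := bounded l.+1 isT.
have PV n : P (~` visits l.+1 n i) = (surv a c d id (fun j => (j == l.+1)%:R) n i)%:E.
  rewrite probability_setC; last exact: (measurable_desc_det id).
  rewrite (prob_desc xiP (phi := id) (fun _ h => h) a_gt0 c_gt0 d_gt1 pG)//.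
  rewrite -EFinB subKr; congr (surv _ _ _ _ _ _ _)%:E; apply/funext => j /=.
  by rewrite negbK; case: j.
apply: (@le_lt_trans _ _ A%:E); last by rewrite ltry.
apply: lime_le; first by apply: is_cvg_nneseries => n _ _; exact: measure_ge0.
apply: nearW => N; rewrite big_mkord (eq_bigr (fun n : 'I_N =>
  (surv a c d id (fun j => (j == l.+1)%:R) n i)%:E)); last by move=> n _; exact: PV.
by rewrite sumEFin lee_fin; exact: AP.
Qed.

(** Partial extinction makes the finitely many types carrying [f] disappear from some time [m] on,
    whereas generation [m] avoids them with probability at most [1 - f i], for every [m]. *)
Lemma partial_extinction_le (f : nat -> R) N i : (0 < i)%N ->
  unit_vec f -> f 0%N = 0 -> (forall j, (N <= j)%N -> f j = 0) ->
  (forall j, f j <= surv_op a c d f j) -> partial_extinction P (Z xi) i <= 1 - f i.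
Proof.
move=> i0 f01 f0 fN fF; rewrite /partial_extinction partialE.
set A := \bigcap_l _.
have fA : P A \is a fin_num by apply: fin_num_measure; exact: measurable_partial.
rewrite -lee_fin fineK//.
(* Type 0 is allowed, as partial extinction only speaks of positive types. *)
pose Q j := (j == 0)%N || (N <= j)%N.
pose C m := \bigcap_n desc xi (fun _ j _ => j) Q (m + n) ([::], i).
have mC m : measurable (C m).
  by apply: bigcapT_measurable => n; exact: (measurable_desc_det id).
have mUC : measurable (\bigcup_m C m) by exact: bigcupT_measurable.
apply: (@le_trans _ _ (P (\bigcup_m C m))).
  apply: le_measure; rewrite ?inE//; first exact: measurable_partial.
  move=> w Aw.
  have [m mP] : exists m, forall l n, (l < N)%N -> (m <= n)%N -> Z xi i n w l.+1 = 0%N.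
    elim: (N) => [|N' [m IH]]; first by exists 0%N.
    have [m' h] := iffLR (nat_cvg0 _ _) (Aw N' Logic.I).
    exists (maxn m m') => l n; rewrite ltnS leq_eqVlt geq_max => /orP[/eqP ->|lN]
      /andP[mn mn'].
      exact: h.
    exact: IH.
  exists m => // n _; rewrite /desc /=.
  rewrite -(all_generation _ (fun _ j => j)); apply/allP => x xg; rewrite /Q /=.
  case: x xg => v [//|j] xg /=; rewrite leqNgt; apply/negP => jN.
  have /population_type_eq0 := mP j (m + n)%N (ltnW jN) (leq_addr _ _).
  by rewrite -(all_generation _ (fun _ j => j)) => /allP/(_ _ xg); rewrite /= eqxx.
have cC : (P \o C) @ \oo --> P (\bigcup_m C m).
  apply: nondecreasing_cvg_mu => //.
  apply/nondecreasing_seqP => m; apply/subsetPset => w Cw n _.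
  by rewrite addSnnS; exact: Cw.
rewrite -(cvg_lim _ cC)//; apply: lime_le; first by apply/cvg_ex; eexists; exact: cC.
apply: nearW => m /=.
apply: (@le_trans _ _ (P (desc xi (fun _ j _ => j) Q m ([::], i)))).
  apply: le_measure; rewrite ?inE//.
  by move=> w /(_ 0%N Logic.I); rewrite addn0.
rewrite (prob_desc xiP (phi := id) (fun _ h => h) a_gt0 c_gt0 d_gt1 pG)// lee_fin lerD2l
  lerN2.
apply: surv_ge => //; first by move=> j; rewrite ler0n lern1 leq_b1.
move=> j; rewrite /Q negb_or; case: j => [|j]; first by rewrite f0.
rewrite -ltnNge /=; have [jN|jN] := ltnP j.+1 N; last by rewrite fN.
by case/andP: (f01 j.+1).
Qed.

End WithLaw.
End Extinction.

(** * Convergence along subsequences and the three regimes *)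

Section Assembly.
Context {R : realType} (a c d : R).
Hypotheses (a_gt0 : 0 < a) (c_gt0 : 0 < c) (d_gt1 : 1 < d).
Local Notation survival := (survival a c d).

Lemma cvg_seqP (u : nat -> R) (l : R) :
  (forall e, 0 < e -> exists K, forall k, (K <= k)%N -> `|u k - l| <= e) -> u @ \oo --> l.
Proof.
move=> h; apply/cvgrPdist_le => e e0; have [K hK] := h e e0.
by exists K => // k /= Kk; rewrite distrC hK.
Qed.

Lemma survival_minn_cvg (sub : nat -> nat) (e : R) K i : (0 < i)%N -> 0 < e ->
  (forall n, (n <= sub n)%N) ->
  (forall n j, (K <= sub n)%N -> (0 < j <= sub n)%N -> e <= survival (minn (sub n)) j) ->
  (fun n => survival (minn (sub n)) (minn (sub n) i)) @ \oo --> survival id i.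
Proof.
move=> i0 e0 sub_ge unif; apply: cvg_seqP => t t0.
have [K1 h1] := survival_minn_upper a_gt0 c_gt0 d_gt1 i t0.
have [||K2 h2] := @survival_minn_lower _ a c d a_gt0 c_gt0 d_gt1
  (fun k => `[< exists n, k = sub n >]) e K e0 _ _ i t t0.
- by move=> n; exists (sub n) => //; apply/asboolP; exists n.
- by move=> k j Kk /asboolP[n kE]; rewrite kE in Kk *; exact: unif.
exists (maxn i (maxn K1 K2)) => n; rewrite !geq_max => /and3P[ni nK1 nK2].
have sn := sub_ge n.
rewrite (minn_idPr (leq_trans ni sn)) ler_distl h1 ?(leq_trans nK1)// andbT.
by apply: h2; [exact: leq_trans sn|apply/asboolP; exists n].
Qed.

Lemma survival_minn_cvg0 (sub : nat -> nat) i : (0 < i)%N ->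
  (forall n, (n <= sub n)%N) -> survival id i = 0 ->
  (fun n => survival (minn (sub n)) (minn (sub n) i)) @ \oo --> survival id i.
Proof.
move=> i0 sub_ge s0; apply: cvg_seqP => t t0.
have [K1 h1] := survival_minn_upper a_gt0 c_gt0 d_gt1 i t0.
exists (maxn i K1) => n; rewrite geq_max => /andP[ni nK1].
rewrite (minn_idPr (leq_trans ni (sub_ge n))) s0 subr0 ger0_norm; last first.
  by case/andP: (survival_unit a_gt0 c_gt0 d_gt1 (minn (sub n)) i).
by have := h1 _ (leq_trans nK1 (sub_ge n)); rewrite s0 add0r.
Qed.

End Assembly.

Theorem proposition2 (R : realType) (a c d : R)
    (p : nat -> config -> R)
    (disp : measure_display) (T : measurableType disp) (P : probability T R)
    (xi : label -> nat -> T -> config) (rho : nat -> label -> T -> nat)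
    (a_gt0 : 0 < a) (c_gt0 : 0 < c) (d_gt1 : 1 < d)
    (pG : forall i (s : nat -> R), (0 < i)%N -> (forall j, 0 <= s j <= 1) ->
       progeny_gf (p i) s = (G a c d i s)%:E)
    (xiP : offspring_variables P p xi)
    (rhoP : forall k, (0 < k)%N ->
       replacement_variables P xi k (point_mass k) (rho k)) :
  let q := global_extinction P (Z xi) in
  let qtilde := partial_extinction P (Z xi) in
  let qbar := fun k => global_extinction P (Zbar xi k (rho k)) in
  let one := fun _ : nat => 1 : R in
  let x := (1 + Num.sqrt (1 - 4 * a * c)) / (2 * c) in
  [/\ 1 / 4 < a * c -> cvg_vec qbar q,
      eq_vec qtilde one <-> a * c <= 1 / 4
    & a * c <= 1 / 4 ->
      [/\ x < d^-1 -> cvg_vec qbar q,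
          d^-1 <= x < d ->
            [/\ cvg_vec (fun k => qbar (2 * k + 1)%N) q,
                cvg_vec (fun k => qbar (2 * k)%N) qtilde
              & eq_vec qtilde one]
        & d <= x ->
            [/\ cvg_vec qbar qtilde, eq_vec qtilde q & eq_vec q one] ] ].
Proof.
move=> q qtilde qbar one x.
have d_gt0 : 0 < d := lt_trans ltr01 d_gt1.
have dV_lt1 : d^-1 < 1 by rewrite invf_lt1.
have odd_ge n : (n <= 2 * n + 1)%N by clear; lia.
have qE i : (0 < i)%N -> q i = 1 - survival a c d id i.
  by move=> i0; rewrite /q (global_extinction_Z xiP a_gt0 c_gt0 d_gt1 pG).
have qbarE k i : (0 < k)%N -> (0 < i)%N ->
    qbar k i = 1 - survival a c d (minn k) (minn k i).
  by move=> k0 i0; rewrite /qbar (global_extinction_Zbar xiP a_gt0 c_gt0 d_gt1 pG _ _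
    (rhoP k k0)).
have qbar_cvg (sub : nat -> nat) : (forall n, (n <= sub n)%N) ->
    (forall i, (0 < i)%N -> (fun n => survival a c d (minn (sub n)) (minn (sub n) i))
       @ \oo --> survival a c d id i) ->
    cvg_vec (fun n => qbar (sub n)) q.
  move=> sub_ge h i i0; rewrite qE//.
  have : (fun n => 1 - survival a c d (minn (sub n)) (minn (sub n) i)) @ \oo
      --> 1 - survival a c d id i by apply: cvgB; [exact: cvg_cst|exact: h].
  apply: cvg_trans; apply: near_eq_cvg; exists 1%N => // n /= n0.
  by rewrite qbarE// (leq_trans n0).
(* These ratios are the values of [D] for the local bound: the top is favourable when [x < d] for
   odd [k], and when [x < d^-1] for even [k]. *)
have odd_weight k : odd k -> weight d k = d * weight d k.+1.
  by move=> ok; rewrite /weight /= ok /= mulr1.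
have even_weight k : ~~ odd k -> weight d k = d^-1 * weight d k.+1.
  by move=> ok; rewrite /weight /= (negbTE ok) /= mulVf// gt_eqF.
have rootP : a * c <= 1 / 4 ->
    [/\ 0 < x, c * x ^+ 2 - x + a = 0 & 1 <= 2 * c * x].
  move=> ac; have disc : 0 <= 1 - 4 * a * c by lra.
  have s0 := sqrtr_ge0 (1 - 4 * a * c); have s2 := sqr_sqrtr disc.
  have c2 : 0 < 2 * c by rewrite mulr_gt0.
  have x2 : 2 * c * x = 1 + Num.sqrt (1 - 4 * a * c).
    by rewrite mulrC /x divfK// gt_eqF.
  split.
  - by rewrite divr_gt0// ltr_wpDr.
  - have E : 4 * c * (c * x ^+ 2 - x + a) = 0.
      have -> : 4 * c * (c * x ^+ 2 - x + a) =
          (2 * c * x) ^+ 2 - 2 * (2 * c * x) + 4 * a * c.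
        by clear; move: (x) => z; ring.
      by rewrite x2 sqrrD s2; ring.
    by move/eqP: E; rewrite mulf_eq0 gt_eqF ?mulr_gt0//= => /eqP.
  - by rewrite x2 lerDl.
have qtilde1 : a * c <= 1 / 4 -> eq_vec qtilde one.
  move=> /rootP[x0 xr _] i i0; rewrite /qtilde.
  rewrite (partial_extinction_eq1 xiP a_gt0 c_gt0 d_gt1 pG)// => l l0.
  have [A AP] := surv_sum_bounded a_gt0 c_gt0 d_gt1 x0 xr l0.
  by exists (A * superw a d x i) => N; exact: AP.
split.
- move=> ac; apply: (qbar_cvg id) => // i i0.
  have [K [e [e0 unif]]] := survival_minn_ge_supercritical a_gt0 c_gt0 d_gt1 ac.
  by apply: (survival_minn_cvg a_gt0 c_gt0 d_gt1 (sub := id) (e := e) (K := K)).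
- split=> // q1; rewrite leNgt; apply/negP => ac.
  (* The window starting at 0 gives type 1 a positive chance of surviving locally. *)
  have [N [e [N1 e0 /(_ 0%N)[f [f01 f0 fN fe fF]]]]] := block_sub a_gt0 c_gt0 d_gt1 ac.
  have := partial_extinction_le xiP a_gt0 c_gt0 d_gt1 pG (ltn0Sn 0) f01 f0 fN fF.
  have := fe 1%N; rewrite N1 => /(_ isT); rewrite -/qtilde q1// /one.
  by lra.
move=> ac; have [x0 xr xl] := rootP ac.
have q_eq1 : 1 <= x -> forall i, survival a c d id i = 0.
  rewrite le_eqVlt => /orP[/eqP x1|x1] i.
    apply: survival_eq0_eq1 => //; move: xr; rewrite -x1; lra.
  exact: (survival_eq0_gt1 a_gt0 c_gt0 d_gt1 x0 xr).
(* From [k] to [k.+1], [superg] grows by a factor at least [x], while the weight is divided by [d]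
   for odd [k] and multiplied by [d] for even [k]. *)
have top_odd k : odd k -> d <= x ->
    weight d k * superg a x k <= weight d k.+1 * superg a x k.+1.
  move=> ok dx; rewrite odd_weight// [d * _]mulrC -mulrA ler_pM2l ?weight_gt0//.
  apply: le_trans (superg_growth a_gt0 x0 k).
  rewrite ler_wpM2r//; case: k ok => // k _; apply: ltW; exact: (superg_gt0 a_gt0 x0).
have top_even k : ~~ odd k -> d^-1 <= x ->
    weight d k * superg a x k <= weight d k.+1 * superg a x k.+1.
  move=> ok dx; rewrite even_weight// [d^-1 * _]mulrC -mulrA ler_pM2l ?weight_gt0//.
  apply: le_trans (superg_growth a_gt0 x0 k).
  rewrite ler_wpM2r//; case: k ok => [|k] _; first by rewrite superg0.
  apply: ltW; exact: (superg_gt0 a_gt0 x0).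
have local D : x < 1 -> x < D -> exists (K : nat) (e : R), 0 < e /\
    forall k i, (K <= k)%N -> weight d k = D * weight d k.+1 -> (0 < i <= k)%N ->
      e <= survival a c d (minn k) i.
  exact: survival_minn_ge_local.
split.
- move=> xd; have x1 := lt_trans xd dV_lt1.
  have [K1 [e1 [e10 unif1]]] := local _ x1 xd.
  have [K2 [e2 [e20 unif2]]] := local _ x1 (lt_trans x1 d_gt1).
  apply: (qbar_cvg id) => // i i0.
  apply: (survival_minn_cvg a_gt0 c_gt0 d_gt1 (sub := id) (e := Num.min e1 e2) (K := maxn
    K1 K2)) => //.
    by rewrite lt_min e10.
  move=> k j; rewrite geq_max => /andP[k1 k2] jk.
  rewrite ge_min; have [ok|ok] := boolP (odd k).
    by rewrite (unif2 k j k2 (odd_weight k ok) jk) orbT.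
  by rewrite (unif1 k j k1 (even_weight k ok) jk).
- move=> /andP[dx xd]; split=> //; last exact: qtilde1.
    apply: (qbar_cvg (fun n => (2 * n + 1)%N)) => // i i0.
    (* For [x < 1] the odd top is favourable, with [D = d]; for [1 <= x] the limiting survival is 0
       and the upper bound suffices. *)
    have [x1|x1] := ltP x 1; last first.
      by apply: survival_minn_cvg0 => //; exact: q_eq1.
    have [K [e [e0 unif]]] := local _ x1 xd.
    apply: (survival_minn_cvg a_gt0 c_gt0 d_gt1 (sub := fun n => (2 * n + 1)%N) (e := e)
      (K := K)) => //.
    move=> n j nK jn; apply: (unif _ _ nK _ jn); apply: odd_weight.
    by rewrite oddD oddM.
  move=> i i0; rewrite (qtilde1 ac)//.
  apply: (@cvg_trans _ ((fun _ : nat => 1 : R) @ \oo)); last exact: cvg_cst.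
  apply: near_eq_cvg; exists 1%N => // n /= n0.
  rewrite qbarE ?muln_gt0//.
  rewrite (survival_minn_eq0 a_gt0 c_gt0 d_gt1 x0 xr) ?subr0 ?geq_minl//.
  by apply: top_even => //; rewrite oddM.
- move=> dx; have x1 : 1 < x := lt_le_trans d_gt1 dx.
  have q1 : eq_vec q one by move=> i i0; rewrite qE// q_eq1 ?subr0// ltW.
  split=> //; last by move=> i i0; rewrite (qtilde1 ac)// q1.
  move=> i i0; rewrite (qtilde1 ac)//.
  apply: (@cvg_trans _ ((fun _ : nat => 1 : R) @ \oo)); last exact: cvg_cst.
  apply: near_eq_cvg; exists 1%N => // k /= k0.
  rewrite qbarE// (survival_minn_eq0 a_gt0 c_gt0 d_gt1 x0 xr) ?subr0 ?geq_minl//.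
  have [ok|ok] := boolP (odd k); first exact: top_odd.
  by apply: top_even => //; rewrite (le_trans _ (ltW x1))// ltW.
Qed.
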